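(* Let $\Omega\subseteq\mathbb{R}^n$ be an open set, let $1\le p<\infty$ and let $w$ be a weight. If $f\in RBV^p(\Omega,w)$, then $$\|\nabla f\|_{L^p(\Omega,w)}\le C\,V_p(f;\Omega,w),$$ where $\nabla f$ is the weak gradient of $f$ and the constant $C>0$ does not depend on $f$.
   Context: A weight is a non-negative, locally integrable function $w$ on $\mathbb{R}^n$, and $w(E)=\int_E w(x)\,dx$. $\|g\|_{L^p(\Omega,w)}=\big(\int_\Omega|g|^p w\,dx\big)^{1/p}$. For $f:\Omega\to\mathbb{R}$ and $E\subset\Omega$, $\operatorname{osc}_E(f)=\sup_{x,y\in E}|f(x)-f(y)|$. The weighted Riesz $p$-variation of a measurable $f:\Omega\to\mathbb{R}$ is $$V_p(f;\Omega,w)=\sup\Big[\sum_{B_k\in\mathcal{D}}\Big(\frac{\operatorname{osc}_{B_k}(f)}{r_k}\Big)^p w(B_k)\Big]^{1/p},$$ where the supremum is over all countable collections $\mathcal{D}=\{B_k\}$ of pairwise disjoint open balls $B_k$ of radius $r_k$ contained in $\Omega$. $RBV^p(\Omega,w)$ is the set of measurable $f:\Omega\to\mathbb{R}$ with $V_p(f;\Omega,w)<\infty$.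
   Formalization: The inequality is proved for those f in RBV^p(Ω,w) that are locally integrable and have a locally integrable weak gradient; existence of the weak gradient is assumed, since it fails in general (n=1, p=1, w=1, f the Heaviside function). *)

(* Defs.v *)
From HB Require Import structures.
From mathcomp Require Import all_boot all_order all_algebra.
From mathcomp Require Import all_classical all_reals all_analysis.

Set Implicit Arguments.
Unset Strict Implicit.
Unset Printing Implicit Defensive.

Import Order.TTheory GRing.Theory Num.Theory.
Import numFieldNormedType.Exports.

Local Open Scope classical_set_scope.
Local Open Scope ring_scope.

(* R^n is 'rV[R]_n with the product (= Borel) sigma-algebra, generated by the
   coordinates exactly as the library does for n.-tuple. *)
Section measurable_rV.
Context {R : realType}.
Variable n : nat.

Let coors : 'I_n -> 'rV[R]_n -> measurableTypeR R := fun i x => x ord0 i.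

Let rV_set0 : g_sigma_preimage coors set0.
Proof. exact: sigma_algebra0. Qed.

Let rV_setC A : g_sigma_preimage coors A -> g_sigma_preimage coors (~` A).
Proof. exact: sigma_algebraC. Qed.

Let rV_bigcup (F : _^nat) : (forall i, g_sigma_preimage coors (F i)) ->
  g_sigma_preimage coors (\bigcup_i (F i)).
Proof. exact: sigma_algebra_bigcup. Qed.

HB.instance Definition _ := @isMeasurable.Build default_measure_display
  'rV[R]_n (g_sigma_preimage coors) rV_set0 rV_setC rV_bigcup.

Lemma measurable_coor (i : 'I_n) :
  measurable_fun [set: 'rV[R]_n] (fun x : 'rV[R]_n => x ord0 i : measurableTypeR R).
Proof.
move=> _ Y mY; rewrite setTI; apply: sub_sigma_algebra => /=.
rewrite -bigcup_seq/=; exists i => /=; first by rewrite mem_index_enum.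
by exists Y => //; rewrite setTI.
Qed.

Lemma measurable_fun_coorP d (T : measurableType d) (f : T -> 'rV[R]_n) :
  (forall i, measurable_fun [set: T] (fun t => f t ord0 i : measurableTypeR R)) ->
  measurable_fun [set: T] f.
Proof.
move=> mf; suff H : g_sigma_preimage (fun i t => coors i (f t)) `<=` measurable.
  move=> _ A mA; rewrite setTI; apply: H.
  have := @g_sigma_preimage_comp _ (measurableTypeR R) n _ coors _ f.
  by rewrite /comp => ->; exists A => //; rewrite setTI.
apply: smallest_sub; first exact: sigma_algebra_measurable.
rewrite -bigcup_seq => B [i _ [A mA <-]].
exact: (mf i).
Qed.

End measurable_rV.

(* The point (a, x_0, ..., x_(n-1)), for the pair (x, a). *)
Definition rV_cons {R : realType} {n : nat}
    (xa : 'rV[R]_n * measurableTypeR R) : 'rV[R]_n.+1 :=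
  row_mx (const_mx xa.2 : 'rV[R]_1) xa.1.

Lemma measurable_rV_cons {R : realType} {n : nat} :
  measurable_fun [set: 'rV[R]_n * measurableTypeR R] (@rV_cons R n).
Proof.
apply: measurable_fun_coorP => i; rewrite /rV_cons.
have [j ->|j ->] := split_ordP (i : 'I_(1 + n)).
- apply: (eq_measurable_fun snd) => [t _|]; last exact: measurable_snd.
  by rewrite (@row_mxEl _ 1 1 n) mxE.
- apply: (eq_measurable_fun ((fun x : 'rV[R]_n => x ord0 j) \o fst)) => [t _|].
    by rewrite (@row_mxEr _ 1 1 n).
  by apply: measurableT_comp; [exact: measurable_coor|exact: measurable_fst].
Qed.

Section borel_lebesgue.
Context {R : realType}.
Local Open Scope ereal_scope.

Section step.
Variables (n : nat) (m : {measure set 'rV[R]_n -> \bar R}).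

Definition borel_lebesgue_step : set 'rV[R]_n.+1 -> \bar R :=
  pushforward (m \x @lebesgue_measure R) (@rV_cons R n).

Let step_measure : {measure set 'rV[R]_n.+1 -> \bar R} :=
  measure_function_pushforward__canonical__measure_function_Measure
    (m \x @lebesgue_measure R) (@measurable_rV_cons R n).

Let step0 : borel_lebesgue_step set0 = 0.
Proof. exact: (measure0 step_measure). Qed.

Let step_ge0 A : 0 <= borel_lebesgue_step A.
Proof. exact: (measure_ge0 step_measure). Qed.

Let step_sigma_additive : semi_sigma_additive borel_lebesgue_step.
Proof. exact: (@measure_semi_sigma_additive _ _ _ step_measure). Qed.

HB.instance Definition _ := isMeasure.Build _ _ _ borel_lebesgue_step
  step0 step_ge0 step_sigma_additive.

End step.

(* Lebesgue measure on the Borel sets of R^n, as an iterated product. *)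
Fixpoint borel_lebesgue (n : nat) : {measure set 'rV[R]_n -> \bar R} :=
  match n with
  | 0 => \d_(0%R : 'rV[R]_0)
  | n'.+1 => borel_lebesgue_step (borel_lebesgue n')
  end.

End borel_lebesgue.
Arguments borel_lebesgue : clear implicits.

(* R^n with the sigma-algebra of Lebesgue measurable sets. *)
Definition lebesgue_space (R : realType) (n : nat) : measurableType _ :=
  caratheodory_type ((borel_lebesgue R n)^*)%mu.

(* The (complete) Lebesgue measure on R^n. *)
Definition lebesgue_rV (R : realType) (n : nat) :
    {measure set (lebesgue_space R n) -> \bar R} :=
  @completed_measure_extension _ _ _ (borel_lebesgue R n).

Section riesz_variation.
Context {R : realType} {n : nat}.
Implicit Types (Omega E : set 'rV[R]_n) (w f phi : 'rV[R]_n -> R).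

Local Notation leb := (lebesgue_rV R n).

Definition lebesgue_measurable_fun E f :=
  @measurable_fun _ _ (lebesgue_space R n) (measurableTypeR R) E f.

Definition locally_integrable_rV E f :=
  lebesgue_measurable_fun E f /\
  forall K : set 'rV[R]_n, K `<=` E -> compact K ->
    (\int[leb]_(x in K) `|f x|%:E < +oo)%E.

Definition is_weight w :=
  (forall x, 0 <= w x) /\ locally_integrable_rV [set: 'rV[R]_n] w.

(* w(E) *)
Definition weight_of w E : \bar R := (\int[leb]_(x in E) (w x)%:E)%E.

(* The library norm on 'rV[R]_n is the sup norm. *)
Definition enorm (x : 'rV[R]_n) : R := Num.sqrt (\sum_i x ord0 i ^+ 2).

Definition eball (c : 'rV[R]_n) (r : R) : set 'rV[R]_n :=
  [set x | enorm (x - c) < r].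

(* ||g||_{L^p(Omega, w)} for a vector-valued g, with |g| its Euclidean norm *)
Definition weighted_Lnorm Omega w (p : R) (g : 'rV[R]_n -> 'rV[R]_n) : \bar R :=
  ((\int[leb]_(x in Omega) ((enorm (g x) `^ p) * w x)%:E) `^ p^-1)%E.

Definition osc E f : \bar R :=
  ereal_sup [set `|f z.1 - f z.2|%:E | z in E `*` E].

(* Countable (possibly finite or empty) families of pairwise disjoint open
   balls contained in Omega; a ball is given by its centre and radius. *)
Definition disjoint_balls Omega (D : set ('rV[R]_n * R)) :=
  [/\ countable D,
      forall b, D b -> 0 < b.2 /\ eball b.1 b.2 `<=` Omega &
      trivIset D (fun b => eball b.1 b.2)].

(* Here 0 * +oo = 0: balls of zero weight do not contribute. *)
Definition variation_sum w (p : R) f (D : set ('rV[R]_n * R)) : \bar R :=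
  \esum_(b in D)
    ((osc (eball b.1 b.2) f * (b.2^-1)%:E) `^ p * weight_of w (eball b.1 b.2))%E.

Definition riesz_variation Omega w (p : R) f : \bar R :=
  (ereal_sup [set variation_sum w p f D | D in disjoint_balls Omega] `^ p^-1)%E.

Definition RBV Omega w (p : R) f :=
  lebesgue_measurable_fun Omega f /\ (riesz_variation Omega w p f < +oo)%E.

Definition partial (i : 'I_n) phi : 'rV[R]_n -> R :=
  fun x => 'D_(delta_mx ord0 i) phi x.

(* C^k regularity on R^n through iterated partial derivatives *)
Fixpoint Ck (k : nat) phi : Prop :=
  match k with
  | 0 => continuous phi
  | k'.+1 => continuous phi /\ forall i : 'I_n,
      (forall x, derivable phi x (delta_mx ord0 i)) /\ Ck k' (partial i phi)
  end.

(* phi \in C_c^oo(Omega), extended by 0 *)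
Definition test_function Omega phi :=
  [/\ forall k, Ck k phi,
      compact (closure [set x | phi x != 0]) &
      closure [set x | phi x != 0] `<=` Omega].

Definition is_weak_gradient Omega f (g : 'rV[R]_n -> 'rV[R]_n) :=
  locally_integrable_rV Omega f /\
  forall i : 'I_n,
    locally_integrable_rV Omega (fun x => g x ord0 i) /\
    forall phi, test_function Omega phi ->
      \int[leb]_(x in Omega) (f x * partial i phi x) =
      - \int[leb]_(x in Omega) (g x ord0 i * phi x).

End riesz_variation.

(* Main.v *)
From HB Require Import structures.
Require Import Defs.
From mathcomp Require Import all_boot all_order all_algebra.
From mathcomp Require Import all_classical all_reals all_analysis.
From mathcomp Require Import measurable_realfun simple_functions archimedean ring lra zify.
Import Order.TTheory GRing.Theory Num.Theory.
Import numFieldNormedType.Exports.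
Local Open Scope classical_set_scope.
Local Open Scope ring_scope.
Set Implicit Arguments.
Unset Strict Implicit.
Unset Printing Implicit Defensive.

(** The weak gradient is tested against smooth kernels placed on a dyadic grid,
    and the mesh of the grid then goes to zero.

    Cut R^n into the dyadic cubes Q of side 2^-k.  The balls B_Q inscribed in
    these cubes are pairwise disjoint, so any collection of them that lies in
    Omega is admissible in the variation.  In each B_Q put a smooth kernel
    phi_Q, a product of one-variable bumps, with integral 1, bounded by C/|Q|,
    and with partial derivatives bounded by C/(r_Q |Q|), where r_Q is the
    radius of B_Q.  For a function u let A_k u be the function whose constant
    value on Q is the integral of u phi_Q.  Three facts about A_k carry the
    argument.
    - A_k u tends to u in L^1 ([cube_average_cvg_L1]).  Indeed A_k is bounded
      on L^1 uniformly in k, it fixes the functions that are constant on the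
      cubes of level k, and those are dense ([integrable_L1_approximable]).
    - If g is the weak gradient of f, then |A_k g_i| <= C osc_{B_Q}(f) / r_Q
      on every Q contained in Omega ([gradient_average_le]): a partial
      derivative of phi_Q has mean zero, so f may be replaced by f minus its
      value at the centre of B_Q.
    - |Q| A_k w <= C w(B_Q) on Q ([kernel_weight_le]).

    If U is a union of cubes of level k in Omega, the last two facts bound the
    integral of |A_k g_i|^p A_k w over U by C times one of the sums whose
    supremum is V_p(f; Omega, w)^p ([level_integral_le]).  To pass to the limit
    with L^1 convergence only, both factors are truncated at a height M:
    (s, t) |-> min(s, M)^p min(t, M) is Lipschitz ([truncated_product_le]), so
    the bound survives the limit k -> oo ([window_bound]), and monotone
    convergence then removes M and lets U increase to Omega
    ([coordinate_bound]).  Summing over the coordinates gives the result. *)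

(** * Lebesgue measure of products *)

Section product_integral.
Context {R : realType}.
Local Open Scope ereal_scope.

Lemma fubini_tonelli1_sigma_finite d1 d2 (T1 : measurableType d1)
    (T2 : measurableType d2) (m1 : {measure set T1 -> \bar R})
    (m2 : {sigma_finite_measure set T2 -> \bar R}) (f : T1 * T2 -> \bar R) :
  sigma_finite [set: T1] m1 -> measurable_fun [set: T1 * T2] f -> (forall x, 0 <= f x) ->
  \int[m1 \x m2]_z f z = \int[m1]_x \int[m2]_y f (x, y).
Proof.
move=> s1 mf f0.
pose H2 := isSFinite.Build _ _ _ _ (sfinite_measure_sigma_finite s1).
pose H3 := isSigmaFinite.Build _ _ _ _ s1.
pose m := HB.pack_for (SigmaFiniteMeasure.type T1 R) (Measure.sort m1) H2 H3.
exact: (@fubini_tonelli1 _ _ _ _ _ m m2).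
Qed.

Lemma measurable_fun_rV_coor n (i : 'I_n) (h : R -> R) :
  measurable_fun setT (h : measurableTypeR R -> measurableTypeR R) ->
  measurable_fun setT (fun x : 'rV[R]_n => h (x ord0 i)).
Proof.
by move=> mh; apply: (measurableT_comp mh); exact: measurable_coor.
Qed.

Lemma rV_consE0 n (xa : 'rV[R]_n * measurableTypeR R) :
  rV_cons xa ord0 ord0 = xa.2.
Proof.
rewrite /rV_cons.
have -> : ord0 = lshift n (ord0 : 'I_1) by exact: val_inj.
by rewrite (@row_mxEl _ 1 1 n) mxE.
Qed.

Lemma rV_consES n (xa : 'rV[R]_n * measurableTypeR R) (i : 'I_n) :
  rV_cons xa ord0 (lift ord0 i) = xa.1 ord0 i.
Proof.
rewrite /rV_cons.
have -> : lift ord0 i = rshift 1 i by exact: val_inj.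
by rewrite (@row_mxEr _ 1 1 n).
Qed.

Definition sup_box n (r : R) : set 'rV[R]_n :=
  [set x | forall i, `|x ord0 i| <= r]%R.

Arguments sup_box : clear implicits.

Lemma measurable_sup_box n r : measurable (sup_box n r).
Proof.
rewrite (_ : sup_box n r =
    \bigcap_(i in [set: 'I_n]) [set x : 'rV[R]_n | `|x ord0 i| <= r]%R); last first.
  by apply/seteqP; split=> x /= h i; [move=> _; exact: h|exact: h].
apply: fin_bigcap_measurable => // i _.
have := @measurable_coor R n i measurableT `[- r, r]%classic%R.
rewrite setTI => h; move: (h (measurable_itv _)).
by congr measurable; apply/seteqP; split => x /=; rewrite in_itv/= ler_norml.
Qed.

Lemma borel_lebesgue_sup_box n r : borel_lebesgue R n (sup_box n r) < +oo.
Proof.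
elim: n => [|n IH] /=.
  by rewrite diracE ltry.
rewrite /borel_lebesgue_step /pushforward.
rewrite (_ : _ @^-1` _ = sup_box n r `*` `[- r, r]%classic%R); last first.
  apply/seteqP; split => [[x a] /= h|[x a] /= [h1 h2] i].
    split=> [i|]; last by rewrite /= in_itv/= -ler_norml; have := h ord0; rewrite rV_consE0.
    by have := h (lift ord0 i); rewrite rV_consES.
  have [j ->|->] := unliftP ord0 i; first by rewrite rV_consES; exact: h1.
  by rewrite rV_consE0 ler_norml; move: h2; rewrite /= in_itv.
rewrite product_measure1E//; last exact: measurable_sup_box.
have lt2 : lebesgue_measure `[- r, r]%classic%R < +oo :> \bar R.
  by rewrite lebesgue_measure_itv /=; case: ifP => _; rewrite ltry.
by apply: lte_mul_pinfty => //; rewrite ge0_fin_numE.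
Qed.

(** Needed because Tonelli's theorem asks for sigma-finite factors, while the
    iterated product is only known to be a measure. *)
Lemma borel_lebesgue_sigma_finite n :
  sigma_finite [set: 'rV[R]_n] (borel_lebesgue R n).
Proof.
exists (fun k => sup_box n k%:R).
  apply/seteqP; split=> // x _.
  exists (Num.bound (\sum_i `|x ord0 i|)%R) => //= i.
  rewrite (le_trans _ (ltW (archi_boundP _)))//.
    by rewrite (bigD1 i)//= lerDl sumr_ge0.
  by rewrite sumr_ge0.
by move=> k; split; [exact: measurable_sup_box|exact: borel_lebesgue_sup_box].
Qed.

(** Tonelli's theorem, one coordinate at a time.  This single formula yields the
    measure of a cube (indicators), the mass of a kernel (bumps) and the vanishing
    mean of its derivatives (positive and negative parts of a derivative).  The
    factors are given by real values [I i] so that the product is a real one. *)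
Lemma borel_lebesgue_prod n (b : 'I_n -> R -> R) (I : 'I_n -> R) :
  (forall i x, 0 <= b i x)%R ->
  (forall i, measurable_fun setT (b i : measurableTypeR R -> measurableTypeR R)) ->
  (forall i, \int[lebesgue_measure]_x (b i x)%:E = (I i)%:E) ->
  \int[borel_lebesgue R n]_x (\prod_i b i (x ord0 i))%:E = (\prod_i I i)%:E.
Proof.
elim: n b I => [|n IH] b I b0 mb Ib.
  under eq_integral do rewrite big_ord0.
  rewrite big_ord0 /= integral_cst//=.
  by rewrite probability_setT mule1.
have mprod m (c : 'I_m -> R -> R) : (forall i, measurable_fun setT (c i : measurableTypeR R -> measurableTypeR R)) ->
    measurable_fun setT (fun x : 'rV[R]_m => \prod_i c i (x ord0 i))%R.
  move=> mc; apply: measurable_prod => i _.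
  exact: measurable_fun_rV_coor.
rewrite /= /borel_lebesgue_step ge0_integral_pushforward//; last 3 first.
- exact: measurable_rV_cons.
- by apply/measurable_EFinP; exact: mprod.
- by move=> x _; rewrite lee_fin; apply: prodr_ge0 => i _; exact: b0.
rewrite preimage_setT fubini_tonelli1_sigma_finite; last 3 first.
- exact: borel_lebesgue_sigma_finite.
- apply/measurable_EFinP; exact: (measurableT_comp (mprod _ _ mb) measurable_rV_cons).
- by move=> x; rewrite /= lee_fin prodr_ge0.
pose b' i := b (lift ord0 i).
transitivity (\int[borel_lebesgue R n]_x
    ((\prod_i b' i (x ord0 i))%:E * (I ord0)%:E)).
  apply: eq_integral => x _; rewrite -Ib -ge0_integralZl ?lee_fin ?prodr_ge0//.
  - apply: eq_integral => a _ /=; rewrite big_ord_recl rV_consE0 mulrC -EFinM.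
    by congr (_ * _)%:E; apply: eq_bigr => i _; rewrite rV_consES.
  - by apply/measurable_EFinP; exact: mb.
  - by move=> *; rewrite lee_fin.
  - by move=> i _; exact: b0.
rewrite ge0_integralZr//; last 3 first.
- by apply/measurable_EFinP; apply: (mprod _ b') => i; exact: mb.
- by move=> x _; rewrite lee_fin; apply: prodr_ge0 => i _; exact: b0.
- by rewrite -Ib integral_ge0// => *; rewrite lee_fin.
rewrite (IH b' (fun i => I (lift ord0 i))) => [|i x|i|i].
- by rewrite [in RHS]big_ord_recl mulrC EFinM.
- exact: b0.
- exact: mb.
- exact: Ib.
Qed.

End product_integral.

(** * The completed Lebesgue measure on R^n *)

Section lebesgue_rV_theory.
Context {R : realType} {n : nat}.
Local Open Scope ereal_scope.
Local Notation leb := (lebesgue_rV R n).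
Local Notation bleb := (borel_lebesgue R n).

Lemma borel_lebesgue_measurable (A : set 'rV[R]_n) :
  measurable A -> measurable (A : set (lebesgue_space R n)).
Proof. by move=> mA; exact: caratheodory_measurable_mu_ext. Qed.

Lemma lebesgue_rVE (A : set 'rV[R]_n) : measurable A -> leb A = bleb A.
Proof. by move=> mA; exact: measurable_mu_extE. Qed.

Lemma borel_lebesgue_measurable_fun d (T : measurableType d) (f : 'rV[R]_n -> T) :
  measurable_fun [set: 'rV[R]_n] f -> measurable_fun [set: lebesgue_space R n] f.
Proof.
move=> mf _ Y mY; apply: borel_lebesgue_measurable.
by move: (mf measurableT Y mY).
Qed.

(** The Borel measure is the image of the completed one under the identity. *)
Lemma ge0_integral_lebesgue_rV (f : 'rV[R]_n -> \bar R) :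
  measurable_fun setT f -> (forall x, 0 <= f x) ->
  \int[leb]_x f x = \int[bleb]_x f x.
Proof.
move=> mf f0; pose phi : lebesgue_space R n -> 'rV[R]_n := fun x => x.
have mphi : measurable_fun setT phi.
  by apply: borel_lebesgue_measurable_fun; exact: measurable_id.
have := @ge0_integral_pushforward _ _ _ _ _ phi mphi leb setT f measurableT mf (fun y _ => f0 y).
rewrite preimage_setT => <-; apply: eq_measure_integral => A mA _.
by rewrite /pushforward; exact: lebesgue_rVE.
Qed.

(** The outer measure that defines the completion is an infimum over countable
    Borel covers, and the union of such a cover is Borel. *)
Lemma lebesgue_rV_outer_regular (A : set 'rV[R]_n) (e : R) :
  leb A < +oo -> (0 < e)%R -> exists B : set 'rV[R]_n,
    [/\ measurable B, A `<=` B & leb B <= leb A + e%:E].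
Proof.
move=> Afin e0; have Afn : leb A \is a fin_num by rewrite ge0_fin_numE// outer_measure_ge0.
have [_ [F [mF AF] <-] Fe] := lb_ereal_inf_adherent e0 Afn.
exists (\bigcup_k F k); split => //.
  exact: bigcup_measurable.
rewrite (le_trans _ (ltW Fe))// lebesgue_rVE; last exact: bigcup_measurable.
apply: measure_sigma_subadditive => //; exact: bigcup_measurable.
Qed.

End lebesgue_rV_theory.

(** * Density of functions constant on the cells of a refining sequence of partitions *)

Lemma cvge0_le {R : realType} (u : (\bar R)^nat) (e : R) :
  u @ \oo --> 0%E -> 0 < e -> \forall k \near \oo, (u k <= e%:E)%E.
Proof.
move=> u0 e0; have : nbhs (0%E : \bar R) [set x : \bar R| (x < e%:E)%E].
  have : (0%E < e%:E)%E by rewrite lte_fin.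
  exact: open_ereal_lt'.
move=> /u0 h; have {}h : \forall k \near \oo, (u k < e%:E)%E by [].
by apply: filterS h => k; exact: ltW.
Qed.

Lemma integrable_indic_lty {R : realType} d (T : measurableType d)
    (mu : {measure set T -> \bar R}) (A : set T) :
  measurable A -> (mu A < +oo)%E -> mu.-integrable setT (EFin \o (\1_A : T -> R)).
Proof.
move=> mA Afin; apply/integrableP; split.
  by apply/measurable_EFinP; exact: measurable_indic.
under eq_integral do rewrite /= ger0_norm//.
by rewrite integral_indic// setIT.
Qed.

Section saturated_density.
Local Open Scope ereal_scope.
Context {R : realType} d (T : measurableType d) (mu : {measure set T -> \bar R}).
Variables (J : countType) (q : nat -> T -> J).
Hypothesis q_refine : forall k x y, q k.+1 x = q k.+1 y -> q k x = q k y.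
Hypothesis measurable_fibre : forall k i, measurable (q k @^-1` [set i]).

(** A union of cells of level [N]. *)
Definition saturated N (E : set T) := forall x y, q N x = q N y -> E x -> E y.

Definition fibrewise_cst N (v : T -> R) := forall x y, q N x = q N y -> v x = v y.

Lemma q_refine_le k l x y : (k <= l)%N -> q l x = q l y -> q k x = q k y.
Proof.
move=> kl; rewrite -(subnK kl); elim: (l - k)%N => // m IH.
by rewrite addSn => /q_refine/IH.
Qed.

Lemma saturated_le k l E : (k <= l)%N -> saturated k E -> saturated l E.
Proof. by move=> kl sE x y /(q_refine_le kl); exact: sE. Qed.

Lemma fibrewise_cst_le k l v : (k <= l)%N -> fibrewise_cst k v -> fibrewise_cst l v.
Proof. by move=> kl sE x y /(q_refine_le kl); exact: sE. Qed.

Lemma saturated_measurable N E : saturated N E -> measurable E.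
Proof.
move=> sE.
pose F (i : J) := if `[< exists2 x, E x & q N x = i >] then q N @^-1` [set i] else set0.
have -> : E = \bigcup_i F i.
  apply/seteqP; split=> [x Ex|x [i _]].
    by exists (q N x) => //; rewrite /F; case: asboolP => // -[]; exists x.
  by rewrite /F; case: asboolP => // -[y Ey qy] qx; apply: sE Ey; rewrite qy -qx.
apply: countable_bigcupT_measurable; first exact: countableP.
by move=> i; rewrite /F; case: ifP.
Qed.

Lemma fibrewise_cst_measurable N v : fibrewise_cst N v -> measurable_fun setT v.
Proof.
move=> cv _ Y _; rewrite setTI; apply: (@saturated_measurable N) => x y qxy.
by rewrite /preimage /= (cv x y).
Qed.

Definition symdiff (A E : set T) := (A `\` E) `|` (E `\` A).

Lemma symdiff_measurable A E : measurable A -> measurable E -> measurable (symdiff A E).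
Proof. by move=> mA mE; apply: measurableU; exact: measurableD. Qed.

Section in_window.
Variable K : set T.
Hypotheses (sK : saturated 0 K) (Kfin : mu K < +oo).
Let mK : measurable K. Proof. exact: saturated_measurable sK. Qed.

(** These sets form a sigma-algebra, which is how every set of finite measure is
    reached below; the finite window [K] makes complements and limits harmless. *)
Definition approximable (A : set T) := measurable A /\
  forall e : R, (0 < e)%R ->
    exists N E, saturated N E /\ mu (symdiff (A `&` K) E) <= e%:E.

Lemma approximable_saturated N E : saturated N E -> approximable E.
Proof.
move=> sE; split; first exact: saturated_measurable sE.
move=> e e0; exists N, (E `&` K); split.
  move=> x y qxy [Ex Kx]; split; first exact: sE Ex.
  by apply: sK Kx; exact: q_refine_le qxy.
by rewrite /symdiff setDv setU0 measure0 lee_fin ltW.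
Qed.

Lemma approximableC A : approximable A -> approximable (~` A).
Proof.
move=> [mA hA]; split; first exact: measurableC.
move=> e e0; have [N [E [sE hE]]] := hA e e0; exists N, (K `\` E); split.
  move=> x y qxy [Kx nEx]; split; first by apply: sK Kx; exact: q_refine_le qxy.
  by move=> Ey; apply: nEx; exact: sE Ey.
have mE := saturated_measurable sE.
apply: le_trans hE; apply: le_measure; rewrite ?inE.
- by apply: symdiff_measurable; [apply: measurableI => //; exact: measurableC|exact: measurableD].
- by apply: symdiff_measurable => //; exact: measurableI.
move=> x [[[nAx Kx] nKE]|[[Kx nEx] nAK]].
- right; split; last by case.
  by apply: contrapT => nEx; apply: nKE.
- left; split => //; split => //; apply: contrapT => nAx; exact: nAK.
Qed.

Lemma approximableU A B : approximable A -> approximable B -> approximable (A `|` B).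
Proof.
move=> [mA hA] [mB hB]; split; first exact: measurableU.
move=> e e0; have e20 : (0 < e / 2)%R by rewrite divr_gt0.
have [N [E [sE hE]]] := hA _ e20; have [M [F [sF hF]]] := hB _ e20.
exists (maxn N M), (E `|` F); split.
  move=> x y qxy [Ex|Fx]; [left; apply: sE Ex|right; apply: sF Fx].
    by apply: q_refine_le qxy; exact: leq_maxl.
  by apply: q_refine_le qxy; exact: leq_maxr.
have mE := saturated_measurable sE; have mF := saturated_measurable sF.
have m1 : measurable (symdiff (A `&` K) E).
  by apply: symdiff_measurable => //; exact: measurableI.
have m2 : measurable (symdiff (B `&` K) F).
  by apply: symdiff_measurable => //; exact: measurableI.
rewrite [e]splitr EFinD (le_trans _ (leeD hE hF))//.
rewrite (le_trans _ (measureU2 _ m1 m2))//.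
apply: le_measure; rewrite ?inE; last 2 first.
- exact: measurableU.
- move=> x [[[[Ax|Bx] Kx] nEF]|[[Ex|Fx] nAB]].
  + by left; left; split => // Ex; apply: nEF; left.
  + by right; left; split => // Ex; apply: nEF; right.
  + by left; right; split => // -[Ax Kx]; apply: nAB; split => //; left.
  + by right; right; split => // -[Ax Kx]; apply: nAB; split => //; right.
apply: symdiff_measurable; last exact: measurableU.
by apply: measurableI => //; exact: measurableU.
Qed.

(** The finite unions exhaust the countable one up to a set of small measure,
    because the window has finite measure. *)
Lemma approximable_bigcup (F : (set T)^nat) :
  (forall i, approximable (F i)) -> approximable (\bigcup_i F i).
Proof.
move=> hF; have mF i : measurable (F i) by case: (hF i).
have mUF : measurable (\bigcup_i F i) by exact: bigcup_measurable.
split => // e e0; have e20 : (0 < e / 2)%R by rewrite divr_gt0.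
pose G N := \big[setU/set0]_(i < N) F i.
have aG N : approximable (G N).
  rewrite /G; elim: N => [|N IH].
    by rewrite big_ord0; apply: (@approximable_saturated 0%N).
  by rewrite big_ord_recr; exact: approximableU.
have mG N : measurable (G N) by case: (aG N).
pose H N := K `&` (\bigcup_i F i `\` G N).
have mH N : measurable (H N) by apply: measurableI => //; exact: measurableD.
have H0 : mu \o H @ \oo --> mu (\bigcap_N H N).
  apply: nonincreasing_cvg_mu => //.
  - rewrite (le_lt_trans _ Kfin)//; apply: le_measure; rewrite ?inE//.
    by move=> x [].
  - exact: bigcap_measurable.
  - move=> a b ab; apply/subsetPset => x [Kx [Fx nG]]; split=> //; split=> // Gx.
    by apply: nG; exact: (subset_bigsetU ab).
have capH : \bigcap_N H N = set0.
  apply/seteqP; split=> // x Hx; have [_ [[i _ Fx] _]] := Hx 0%N I.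
  have [_ [_ /=]] := Hx i.+1 I; apply.
  by rewrite /G -bigcup_mkord; exists i => /=.
rewrite capH measure0 in H0.
have [N HN] : exists N, mu (H N) <= (e / 2)%:E.
  have [N _ h] := cvge0_le H0 e20.
  by exists N; exact: (h N (leqnn _)).
have [M [E [sE hE]]] := (aG N).2 _ e20.
exists M, E; split => //.
have mE := saturated_measurable sE.
have m1 : measurable (symdiff (G N `&` K) E).
  by apply: symdiff_measurable => //; exact: measurableI.
rewrite [e]splitr EFinD (le_trans _ (leeD HN hE))//.
rewrite (le_trans _ (measureU2 _ (mH N) m1))//.
apply: le_measure; rewrite ?inE.
- by apply: symdiff_measurable => //; exact: measurableI.
- by apply: measurableU.
move=> x [[[Fx Kx] nEx]|[Ex nFK]].
- have [Gx|nGx] := pselect (G N x); first by right; left; split.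
  by left; split.
- right; right; split => // -[Gx Kx]; apply: nFK; split => //.
  by move: Gx; rewrite /G -bigcup_mkord => -[i _ Fx]; exists i.
Qed.

Lemma approximable_generated A :
  <<s [set E | exists N, saturated N E] >> A -> approximable A.
Proof.
move: A; apply: smallest_sub; last first.
  by move=> E [N sE]; exact: approximable_saturated sE.
split.
- by apply: (@approximable_saturated 0%N).
- by move=> A hA; rewrite setTD; exact: approximableC.
- exact: approximable_bigcup.
Qed.

End in_window.

Variable K : (set T)^nat.
Hypotheses (sK : forall m, saturated 0 (K m)) (Kfin : forall m, mu (K m) < +oo).
Hypotheses (ndK : nondecreasing_seq K) (KT : \bigcup_m K m = setT).
Hypothesis outer_approx : forall A (e : R), measurable A -> mu A < +oo -> (0 < e)%R ->
  exists B, [/\ <<s [set E | exists N, saturated N E] >> B, A `<=` B &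
                mu B <= mu A + e%:E].

(** Three successive errors: cutting to a large window, enlarging to a set of the
    generated sigma-algebra, and replacing that set by a union of cells. *)
Lemma saturated_approx A (e : R) : measurable A -> mu A < +oo -> (0 < e)%R ->
  exists N E, [/\ saturated N E, mu E < +oo & mu (symdiff A E) <= e%:E].
Proof.
move=> mA Afin e0; have e30 : (0 < e / 3)%R by rewrite divr_gt0.
have mK m : measurable (K m) by exact: saturated_measurable (@sK m).
(* The sets [A `\` K m] decrease to the empty set. *)
have [m Hm] : exists m, mu (A `\` K m) <= (e / 3)%:E.
  have : mu \o (fun m => A `\` K m) @ \oo --> mu (\bigcap_m (A `\` K m)).
    apply: nonincreasing_cvg_mu => //.
    - by rewrite (le_lt_trans _ Afin)//; apply: le_measure; rewrite ?inE//; exact: measurableD.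
    - by move=> m; exact: measurableD.
    - by apply: bigcap_measurable => // m _; exact: measurableD.
    - by move=> a b ab; apply/subsetPset; apply: setDS; apply/subsetPset; exact: ndK.
  have -> : \bigcap_m (A `\` K m) = set0.
    apply/seteqP; split=> // x Hx.
    have : (\bigcup_m K m) x by rewrite KT.
    by move=> [m _ Kx]; have [_] := Hx m Logic.I; apply.
  rewrite measure0 => /cvge0_le/(_ e30) [N _ h].
  by exists N; exact: (h N (leqnn _)).
have [B [gB AB muB]] := outer_approx mA Afin e30.
have [mB hB] := approximable_generated (@sK m) (Kfin m) gB.
have [N [E0 [sE0 hE0]]] := hB _ e30.
pose E := E0 `&` K m.
have sE : saturated N E.
  move=> x y qxy [Ex Kx]; split; first exact: sE0 Ex.
  by apply: sK Kx; exact: q_refine_le qxy.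
exists N, E; split => //.
  rewrite (le_lt_trans _ (Kfin m))//; apply: le_measure; rewrite ?inE//.
    exact: saturated_measurable sE.
  by move=> x [].
have mE := saturated_measurable sE; have mE0 := saturated_measurable sE0.
have mBA : mu (B `\` A) <= (e / 3)%:E.
  have Afn : mu A \is a fin_num by rewrite ge0_fin_numE.
  rewrite -(leeD2lE _ _ Afn) (le_trans _ muB)//.
  rewrite -[X in _ <= mu X](setDUK AB) measureU// ?setDIK//; exact: measurableD.
have m3 : measurable (symdiff (B `&` K m) E0).
  by apply: symdiff_measurable => //; exact: measurableI.
have mBA' : measurable (B `\` A) by exact: measurableD.
have mAK : measurable (A `\` K m) by exact: measurableD.
have -> : e = (e / 3 + (e / 3 + e / 3))%R by field.
rewrite !EFinD (le_trans _ (leeD Hm (leeD mBA hE0)))//.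
rewrite (le_trans _ (leeD (lexx _) (measureU2 _ mBA' m3)))//.
rewrite (le_trans _ (measureU2 _ mAK _))//; last exact: measurableU.
apply: le_measure; rewrite ?inE.
- exact: symdiff_measurable.
- by apply: measurableU => //; exact: measurableU.
move=> x [[Ax nEx]|[[Ex Kx] nAx]].
- have [Kx|nKx] := pselect (K m x); last by left.
  right; right; left; split; first by split => //; exact: AB.
  by move=> Ex; apply: nEx.
- right; have [Bx|nBx] := pselect (B x); first by left.
  by right; right; split => // -[].
Qed.

Definition L1_approximable (u : T -> R) := mu.-integrable setT (EFin \o u) /\
  forall e : R, (0 < e)%R -> exists N v,
    [/\ fibrewise_cst N v, mu.-integrable setT (EFin \o v) &
        \int[mu]_x `|u x - v x|%:E <= e%:E].

Lemma L1_approximable_indic A : measurable A -> mu A < +oo ->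
  L1_approximable (\1_A : T -> R).
Proof.
move=> mA Afin; split; first exact: integrable_indic_lty.
move=> e e0; have [N [E [sE Efin hE]]] := saturated_approx mA Afin e0.
have mE := saturated_measurable sE.
exists N, (\1_E); split.
- move=> x y qxy; rewrite !indicE; congr (nat_of_bool _)%:R.
  by apply/idP/idP; rewrite !inE; apply: sE.
- exact: integrable_indic_lty.
rewrite (le_trans _ hE)// -[X in _ <= mu X]setIT -integral_indic//; last exact: symdiff_measurable.
apply: ge0_le_integral => //.
- apply/measurable_EFinP; apply: measurableT_comp => //.
  by apply: measurable_funB; exact: measurable_indic.
- by apply/measurable_EFinP; apply: measurable_indic; exact: symdiff_measurable.
move=> x _; rewrite lee_fin !indicE in_setU !in_setD.
by case: (x \in A); case: (x \in E); rewrite /= ?subrr ?subr0 ?sub0r ?normrN ?normr0 ?normr1.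
Qed.

Lemma L1_approximableZ (c : R) u : L1_approximable u -> L1_approximable (fun x => c * u x)%R.
Proof.
move=> [iu hu]; split.
  by have := integrableZl measurableT c iu; apply: eq_integrable => // x _; rewrite /= EFinM.
move=> e e0; have c0 : (0 < `|c| + 1)%R by rewrite ltr_wpDl.
have [N [v [cv iv hv]]] := hu (e / (`|c| + 1))%R (divr_gt0 e0 c0).
exists N, (fun x => c * v x)%R; split.
- by move=> x y qxy; rewrite (cv x y).
- by have := integrableZl measurableT c iv; apply: eq_integrable => // x _; rewrite /= EFinM.
have mu_ : measurable_fun setT u by apply/measurable_EFinP; exact: measurable_int iu.
have mv : measurable_fun setT v by apply/measurable_EFinP; exact: measurable_int iv.
have -> : \int[mu]_x `|c * u x - c * v x|%:E = `|c|%:E * \int[mu]_x `|u x - v x|%:E.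
  rewrite -ge0_integralZl//.
    by apply: eq_integral => x _; rewrite -EFinM -normrM mulrBr.
  by apply/measurable_EFinP; apply: measurableT_comp => //; exact: measurable_funB.
rewrite (le_trans (lee_wpmul2l _ hv))//= lee_fin.
rewrite mulrCA; apply: ler_piMr; first exact: ltW.
by rewrite ler_pdivrMr// mul1r lerDl.
Qed.

Lemma L1_approximableD u1 u2 : L1_approximable u1 -> L1_approximable u2 ->
  L1_approximable (fun x => u1 x + u2 x)%R.
Proof.
move=> [iu hu] [iu' hu']; split.
  by have := integrableD measurableT iu iu'; apply: eq_integrable => // x _; rewrite /= EFinD.
move=> e e0; have e20 : (0 < e / 2)%R by rewrite divr_gt0.
have [N [v [cv iv hv]]] := hu _ e20; have [N' [v' [cv' iv' hv']]] := hu' _ e20.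
exists (maxn N N'), (fun x => v x + v' x)%R; split.
- move=> x y qxy; congr (_ + _)%R.
    by apply: cv; apply: q_refine_le qxy; exact: leq_maxl.
  by apply: cv'; apply: q_refine_le qxy; exact: leq_maxr.
- by have := integrableD measurableT iv iv'; apply: eq_integrable => // x _; rewrite /= EFinD.
have mu_ : measurable_fun setT u1 by apply/measurable_EFinP; exact: measurable_int iu.
have mv : measurable_fun setT v by apply/measurable_EFinP; exact: measurable_int iv.
have mu' : measurable_fun setT u2 by apply/measurable_EFinP; exact: measurable_int iu'.
have mv' : measurable_fun setT v' by apply/measurable_EFinP; exact: measurable_int iv'.
have m1 : measurable_fun setT (fun x => `|u1 x - v x|%:E).
  by apply/measurable_EFinP; apply: measurableT_comp => //; exact: measurable_funB.
have m2 : measurable_fun setT (fun x => `|u2 x - v' x|%:E).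
  by apply/measurable_EFinP; apply: measurableT_comp => //; exact: measurable_funB.
rewrite [e]splitr EFinD (le_trans _ (leeD hv hv'))// -ge0_integralD//.
apply: ge0_le_integral => //.
- apply/measurable_EFinP; apply: measurableT_comp => //.
  by apply: measurable_funB; exact: measurable_funD.
- exact: emeasurable_funD.
move=> x _; rewrite -EFinD lee_fin.
have -> : (u1 x + u2 x - (v x + v' x) = (u1 x - v x) + (u2 x - v' x))%R by ring.
exact: ler_normD.
Qed.

Lemma L1_approximable0 : L1_approximable (fun=> 0%R).
Proof.
split=> [|e e0]; first exact: integrable0.
exists 0%N, (fun=> 0%R); split => //; first exact: integrable0.
by rewrite integral0_eq ?lee_fin ?ltW// => x _; rewrite subrr normr0.
Qed.

Lemma L1_approximable_sum (S : Type) (s : seq S) (u : S -> T -> R) :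
  (forall i, L1_approximable (u i)) -> L1_approximable (fun x => \sum_(i <- s) u i x)%R.
Proof.
move=> hu; elim: s => [|i s IH].
  by under eq_fun do rewrite big_nil; exact: L1_approximable0.
under eq_fun do rewrite big_cons.
exact: L1_approximableD.
Qed.

Import HBSimple.

(** Simple functions are dense in L^1, and each of their level sets at a nonzero
    value has finite measure. *)
Lemma integrable_L1_approximable u :
  mu.-integrable setT (EFin \o u) -> L1_approximable u.
Proof.
move=> iu; split => // e e0; have e20 : (0 < e / 2)%R by rewrite divr_gt0.
have [g [ig _ /cvge0_le/(_ e20) [m _ /(_ m (leqnn _)) /= hm]]] :=
  approximation_sfun_integrable measurableT iu.
have [ig' hg] : L1_approximable (g m).
  have -> : (g m : T -> R) = fun x => (\sum_(y <- finmap.enum_fset (fset_set (range (g m)))) (y * \1_(g m @^-1` [set y]) x))%R.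
    by apply/funext => x; rewrite fimfunE fsbig_finite.
  apply: L1_approximable_sum => y.
  have [->|y0] := eqVneq y 0%R.
    by under eq_fun do rewrite mul0r; exact: L1_approximable0.
  apply: L1_approximableZ; apply: L1_approximable_indic => //.
  have /integrableP [mg gfin] := ig m.
  have : `|y|%:E * mu (g m @^-1` [set y]) < +oo.
    rewrite (le_lt_trans _ gfin)// -[X in _ * mu X]setIT -integral_indic//.
    rewrite -ge0_integralZl//; last by apply/measurable_EFinP; exact: measurable_indic.
    apply: ge0_le_integral => //.
    - by apply/measurable_EFinP; apply: measurable_funM => //; exact: measurable_indic.
    - by apply: measurableT_comp.
    move=> x _ /=; rewrite -EFinM lee_fin indicE.
    have [|] := boolP (x \in _); last by rewrite mulr0.
    by rewrite inE /= => ->; rewrite mulr1.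
  rewrite !ltey; apply: contra => /eqP ->.
  by rewrite gt0_muley// lte_fin normr_gt0.
have [N [v [cv iv hv]]] := hg _ e20; exists N, v; split => //.
have mu_ : measurable_fun setT u by apply/measurable_EFinP; exact: measurable_int iu.
have mv : measurable_fun setT v by apply/measurable_EFinP; exact: measurable_int iv.
have m1 : measurable_fun setT (fun x => `|u x - g m x|%:E).
  by apply/measurable_EFinP; apply: measurableT_comp => //; exact: measurable_funB.
have m2 : measurable_fun setT (fun x => `|g m x - v x|%:E).
  by apply/measurable_EFinP; apply: measurableT_comp => //; exact: measurable_funB.
rewrite [e]splitr EFinD (le_trans _ (leeD hm hv))// -ge0_integralD//.
apply: ge0_le_integral => //.
- apply/measurable_EFinP; apply: measurableT_comp => //.
  exact: measurable_funB.
- exact: emeasurable_funD.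
move=> x _; rewrite -EFinD lee_fin.
have -> : (u x - v x = (u x - g m x) + (g m x - v x))%R by ring.
exact: ler_normD.
Qed.

End saturated_density.

(** * Averaging against kernels carried by the cells *)

Section kernel_average.
Local Open Scope ereal_scope.
Context {R : realType} d (T : measurableType d) (mu : {measure set T -> \bar R}).
Variables (J : countType) (q : nat -> T -> J).
Hypothesis q_refine : forall k x y, q k.+1 x = q k.+1 y -> q k x = q k y.
Hypothesis measurable_fibre : forall k i, measurable (q k @^-1` [set i]).

(** Countable additivity; the cells are listed through the codes of their indices,
    and a natural number that codes nothing contributes the empty set. *)
Lemma ge0_integral_fibres k (F : T -> \bar R) :
  measurable_fun setT F -> (forall x, 0 <= F x) ->
  \int[mu]_x F x = \esum_(i in [set: J]) \int[mu]_(x in q k @^-1` [set i]) F x.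
Proof.
move=> mF F0.
pose G n := if @pickle_inv J n is Some i then q k @^-1` [set i] else set0.
have UG : \bigcup_n G n = setT.
  apply/seteqP; split => // x _; exists (pickle (q k x)) => //.
  by rewrite /G pickleK_inv.
have tG : trivIset setT G.
  apply/trivIsetP => m n _ _; apply: contra_neqP => /eqP/set0P[x []].
  rewrite /G; case Em: (pickle_inv m) => [i|//]; case En: (pickle_inv n) => [j|//].
  move=> /= qi qj; move: Em En; rewrite -qi -qj => Em En.
  by have := @pickle_invK J m; have := @pickle_invK J n; rewrite Em En /= => -> ->.
rewrite -UG ge0_integral_bigcup//; last 2 first.
- by move=> n; rewrite /G; case: pickle_inv.
- by rewrite UG.
rewrite nneseries_esumT; last by move=> n; exact: integral_ge0.
have bp : set_bij [set: J] (range (@pickle J)) (@pickle J).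
  by apply/inj_bij => x y _ _; exact: (pcan_inj pickleK).
transitivity (\esum_(n in range (@pickle J)) \int[mu]_(x in G n) F x).
  rewrite [RHS]esum_mkcond; apply: eq_esum => n _.
  case: ifPn => //; rewrite notin_setE => nr.
  rewrite /G; case En: (pickle_inv n) => [i|]; last by rewrite integral_set0.
  exfalso; apply: nr; exists i => //.
  by have := @pickle_invK J n; rewrite En.
rewrite (reindex_esum _ _ _ _ bp).
by apply: eq_esum => i _; rewrite /G pickleK_inv.
Qed.

Variables (a : nat -> R) (C : R) (phi : nat -> J -> T -> R).
Hypotheses (a_gt0 : forall k, (0 < a k)%R) (C_ge0 : (0 <= C)%R).
Hypothesis mu_fibre : forall k i, mu (q k @^-1` [set i]) = (a k)%:E.
Hypothesis phi_measurable : forall k i, measurable_fun setT (phi k i).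
Hypothesis phi_ge0 : forall k i x, (0 <= phi k i x)%R.
Hypothesis phi_supp : forall k i x, q k x != i -> phi k i x = 0%R.
Hypothesis phi_le : forall k i x, (a k * phi k i x <= C)%R.
Hypothesis phi_int : forall k i, \int[mu]_x (phi k i x)%:E = 1.

Definition average k (u : T -> R) (x : T) : R :=
  (\int[mu]_y (u y * phi k (q k x) y))%R.

Lemma average_fibrewise_cst k u : fibrewise_cst q k (average k u).
Proof. by move=> x y qxy; rewrite /average qxy. Qed.

Lemma average_measurable k u : measurable_fun setT (average k u).
Proof. exact: fibrewise_cst_measurable (@average_fibrewise_cst k u). Qed.

Lemma integrable_mul_kernel k i u : mu.-integrable setT (EFin \o u) ->
  mu.-integrable setT (EFin \o (fun y => u y * phi k i y)%R).
Proof.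
move=> iu; have mu_ : measurable_fun setT u by apply/measurable_EFinP; exact: measurable_int iu.
apply: (le_integrable measurableT) (integrableZl measurableT (C / a k)%R iu).
  by apply/measurable_EFinP; exact: measurable_funM.
move=> x _; rewrite /= lee_fin normrM [leRHS]normrM mulrC.
apply: ler_wpM2r => //.
rewrite ger0_norm// ger0_norm; last by rewrite divr_ge0// ltW.
by rewrite ler_pdivlMr// mulrC.
Qed.

(** Only the values of [u] on the cell of [x] enter the average, and there the
    kernel is at most [C / a k]. *)
Lemma average_le k u x : mu.-integrable setT (EFin \o u) ->
  (a k * `|average k u x|)%:E <= \int[mu]_(y in q k @^-1` [set q k x]) (C * `|u y|)%:E.
Proof.
move=> iu; have iuk := @integrable_mul_kernel k (q k x) _ iu.
have mu_ : measurable_fun setT u by apply/measurable_EFinP; exact: measurable_int iu.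
rewrite EFinM /average EFin_normr_Rintegral//.
have muk := measurable_int _ iuk.
apply: (@le_trans _ _ ((a k)%:E * \int[mu]_y `|(u y * phi k (q k x) y)%:E|)).
  apply: lee_wpmul2l; first by rewrite lee_fin ltW.
  exact: le_abse_integral.
rewrite -ge0_integralZl//; last 2 first.
- by apply: measurableT_comp.
- by rewrite lee_fin ltW.
rewrite [leRHS]integral_mkcond; apply: ge0_le_integral => //.
- by move=> y _; rewrite mule_ge0// lee_fin ltW.
- by apply: measurable_funeM; exact: measurableT_comp.
- apply/(measurable_restrictT _ _).1 => //.
  apply/measurable_EFinP; apply: measurable_funTS; apply: measurable_funM => //.
  exact: measurableT_comp.
move=> y _ /=; rewrite patchE; case: ifPn => [_|].
  rewrite -EFinM lee_fin normrM (ger0_norm (phi_ge0 _ _ _)).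
  by rewrite mulrCA mulrC ler_wpM2r.
by rewrite notin_setE /= => /eqP qxy; rewrite phi_supp// mulr0 normr0 mule0.
Qed.

Lemma fibre_nonempty k i : exists x, q k x = i.
Proof.
have [q0|/set0P [x qx]] := eqVneq (q k @^-1` [set i]) set0; last by exists x.
have := mu_fibre k i; rewrite q0 measure0 => -[] a0.
by have := a_gt0 k; rewrite -a0 ltxx.
Qed.

(** The averages are bounded on L^1 uniformly in the level: integrate
    [average_le] over each cell and sum. *)
Lemma average_contraction k u : mu.-integrable setT (EFin \o u) ->
  \int[mu]_x `|average k u x|%:E <= C%:E * \int[mu]_x `|u x|%:E.
Proof.
move=> iu.
have mu_ : measurable_fun setT u by apply/measurable_EFinP; exact: measurable_int iu.
rewrite -ge0_integralZl//; last by apply/measurable_EFinP; exact: measurableT_comp.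
rewrite (@ge0_integral_fibres k); last 2 first.
- by apply/measurable_EFinP; apply: measurableT_comp => //; exact: average_measurable.
- by [].
rewrite [leRHS](@ge0_integral_fibres k); last 2 first.
- by apply: measurable_funeM; apply/measurable_EFinP; exact: measurableT_comp.
- by move=> x; rewrite mule_ge0.
apply: le_esum => i _.
have [x qx] := fibre_nonempty k i.
rewrite -qx (eq_integral (fun=> `|average k u x|%:E)); last first.
  by move=> y; rewrite inE /= => qy; rewrite (average_fibrewise_cst _ qy).
rewrite integral_cst// mu_fibre -EFinM mulrC.
exact: average_le.
Qed.

Lemma average_cst k v x : fibrewise_cst q k v -> average k v x = v x.
Proof.
move=> cv; rewrite /average.
rewrite (@eq_Rintegral _ _ _ _ _ (fun y => v x * phi k (q k x) y)%R); last first.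
  move=> y _; have [qxy|qxy] := eqVneq (q k y) (q k x); first by rewrite (cv y x).
  by rewrite phi_supp// !mulr0.
rewrite RintegralZl ?/Rintegral ?phi_int ?mulr1//.
apply/integrableP; split; first exact/measurable_EFinP.
by under eq_integral do rewrite /= ger0_norm//; rewrite phi_int ltry.
Qed.

Lemma averageB k u v x : mu.-integrable setT (EFin \o u) -> mu.-integrable setT (EFin \o v) ->
  average k (fun y => u y - v y)%R x = (average k u x - average k v x)%R.
Proof.
move=> iu iv; rewrite /average -RintegralB//.
- by apply: eq_Rintegral => y _; rewrite mulrBl.
- exact: integrable_mul_kernel.
- exact: integrable_mul_kernel.
Qed.

(** Replace [u] by a close function [v] constant on cells: averaging fixes [v] at
    all fine levels, and it moves [u - v] by at most [C] times its norm. *)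
Lemma average_cvg_L1 u (e : R) : L1_approximable mu q u -> (0 < e)%R ->
  \forall k \near \oo, \int[mu]_x `|u x - average k u x|%:E <= e%:E.
Proof.
move=> [iu hu] e0.
have Cp : (0 < C + 1)%R by rewrite ltr_wpDl.
(* The total error is [(1 + C)] times the distance from [u] to [v]. *)
have [N [v [cv iv hv]]] := hu _ (divr_gt0 e0 Cp).
exists N => // k /= Nk.
have {}cv : fibrewise_cst q k v by exact: (fibrewise_cst_le q_refine Nk cv).
have iuv : mu.-integrable setT (EFin \o (fun x => u x - v x)%R).
  by have := integrableB measurableT iu iv; apply: eq_integrable => // x _; rewrite /= EFinB.
have muv : measurable_fun setT (fun x => u x - v x)%R.
  by apply/measurable_EFinP; exact: measurable_int iuv.
have mu_ : measurable_fun setT u by apply/measurable_EFinP; exact: measurable_int iu.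
have mav := average_measurable k (fun x => u x - v x)%R.
have mau := average_measurable k u.
apply: (@le_trans _ _ (\int[mu]_x (`|u x - v x|%:E + `|average k (fun x => u x - v x)%R x|%:E))).
  apply: ge0_le_integral => //.
  - apply/measurable_EFinP; apply: measurableT_comp => //; exact: measurable_funB.
  - by apply: emeasurable_funD; apply/measurable_EFinP; apply: measurableT_comp.
  move=> x _; rewrite -EFinD lee_fin averageB// (average_cst _ cv).
  have -> : (u x - average k u x = (u x - v x) - (average k u x - v x))%R by ring.
  exact: ler_normB.
rewrite ge0_integralD//; last 2 first.
- by apply/measurable_EFinP; apply: measurableT_comp.
- by apply/measurable_EFinP; apply: measurableT_comp.
rewrite (le_trans (leeD (lexx _) (average_contraction k iuv)))//.
rewrite (le_trans (leeD hv (lee_wpmul2l _ hv)))//.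
rewrite -EFinM -EFinD lee_fin le_eqVlt; apply/orP; left; apply/eqP.
by field; rewrite gt_eqF.
Qed.

End kernel_average.

(** For the weight the support of the kernel matters: it lies in the ball [B], so
    the weight of the ball, and not only that of the cube, controls the average. *)
Lemma kernel_weight_le {R : realType} d (T : measurableType d)
    (mu : {measure set T -> \bar R}) (v w phi : T -> R) (B : set T) (a C : R) :
  measurable B -> measurable_fun setT v -> measurable_fun setT w ->
  measurable_fun setT phi -> mu.-integrable setT (EFin \o (fun y => v y * phi y)) ->
  0 <= a -> 0 <= C -> (forall y, 0 <= v y <= w y) -> (forall y, 0 <= phi y) ->
  (forall y, a * phi y <= C) -> (forall y, ~ B y -> phi y = 0) ->
  ((a * \int[mu]_y (v y * phi y))%:E <= C%:E * \int[mu]_(y in B) (w y)%:E)%E.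
Proof.
move=> mB mv mw mphi ivp a0 C0 vw p0 pC pB.
have v0 y : 0 <= v y by case/andP: (vw y).
have w0 y : 0 <= w y by case/andP: (vw y) => /le_trans; exact.
have mvp : measurable_fun setT (fun y => (v y * phi y)%:E).
  by apply/measurable_EFinP; exact: measurable_funM.
have mBw : measurable_fun B (fun y => (w y)%:E).
  by apply/measurable_EFinP; exact: measurable_funTS.
rewrite EFinM /Rintegral fineK; last exact: integrable_fin_num ivp.
rewrite -(ge0_integralZl _ measurableT mvp) ?lee_fin//; last first.
  by move=> y _; rewrite lee_fin mulr_ge0.
rewrite -(ge0_integralZl _ mB mBw) ?lee_fin//; last first.
  by move=> y _; rewrite lee_fin.
rewrite [leRHS]integral_mkcond; apply: ge0_le_integral => //.
- by move=> y _; rewrite -EFinM lee_fin !mulr_ge0.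
- exact: measurable_funeM.
- by apply/(measurable_restrictT _ _).1 => //; exact: measurable_funeM.
move=> y _; rewrite patchE; case: ifPn => [_|].
  rewrite -!EFinM lee_fin mulrCA mulrC; apply: ler_pM => //.
    by rewrite mulr_ge0.
  by case/andP: (vw y).
by rewrite notin_setE => nB; rewrite pB// mulr0 mule0.
Qed.

(** * Dyadic cubes *)

Section dyadic_cubes.
Context {R : realType} {n : nat}.
Local Notation leb := (lebesgue_rV R n).

(** The cube of level [k] containing [x] is encoded by the integer coordinates of
    its lower corner, so that cubes are the fibres of a function. *)
Definition dyadic (k : nat) (x : 'rV[R]_n) : 'rV[int]_n :=
  \row_j Num.floor (2 ^+ k * x ord0 j).

Definition side (k : nat) : R := (2 ^+ k)^-1.

Lemma side_gt0 k : 0 < side k. Proof. by rewrite invr_gt0 exprn_gt0. Qed.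

Lemma dyadicP k x z : dyadic k x = z <->
  forall j, (z ord0 j)%:~R * side k <= x ord0 j < (z ord0 j + 1)%:~R * side k.
Proof.
have p0 : (0 : R) < 2 ^+ k by rewrite exprn_gt0.
split=> [<- j|h].
  rewrite mxE ler_pdivrMr// ltr_pdivlMr// [x _ _ * _]mulrC.
  exact: floor_itv.
apply/rowP => j; rewrite mxE; apply: floor_def.
by have := h j; rewrite ler_pdivrMr// ltr_pdivlMr// [x _ _ * _]mulrC.
Qed.

Lemma dyadic_refine k (x y : 'rV[R]_n) : dyadic k.+1 x = dyadic k.+1 y -> dyadic k x = dyadic k y.
Proof.
move=> xy; apply/esym/dyadicP => j.
have /dyadicP/(_ j) := erefl (dyadic k x).
have /dyadicP/(_ j) := erefl (dyadic k.+1 x).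
have /dyadicP/(_ j) := esym xy.
set u := dyadic k.+1 x ord0 j; set v := dyadic k x ord0 j => /andP[yl yr] /andP[xl xr] /andP[xl' xr'].
have s2 : side k = 2 * side k.+1 by rewrite /side exprS invfM mulrA divff ?mul1r.
have s0 := side_gt0 k.+1.
(* The strict inequalities between reals become [2 v <= u <= 2 v + 1] between
   integers, which is what places the finer cube in the coarser one. *)
have h1 : ((2 * v)%:~R < (u + 1)%:~R :> R).
  rewrite -(ltr_pM2r s0); apply: le_lt_trans xr; apply: le_trans xl'.
  by rewrite s2 mulrA intrM [_ * 2]mulrC.
have h2 : (u%:~R < (2 * (v + 1))%:~R :> R).
  rewrite -(ltr_pM2r s0); apply: le_lt_trans xl _; apply: lt_le_trans xr' _.
  by rewrite s2 mulrA intrM [_ * 2]mulrC.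
rewrite ltr_int in h1; rewrite ltr_int in h2.
have h3 : (2 * v)%:~R <= u%:~R :> R by rewrite ler_int; lia.
have h4 : (u + 1)%:~R <= (2 * (v + 1))%:~R :> R by rewrite ler_int; lia.
apply/andP; split.
  apply: le_trans yl; rewrite s2 mulrA [_ * 2]mulrC -(intrM R 2 v) ler_pM2r//.
apply: lt_le_trans yr _; rewrite s2 mulrA [_ * 2]mulrC -(intrM R 2 (v + 1)) ler_pM2r//.
Qed.

Lemma dyadic_fibreE k z : dyadic k @^-1` [set z] =
  \bigcap_(j in [set: 'I_n]) [set x : 'rV[R]_n |
     `[(z ord0 j)%:~R * side k, (z ord0 j + 1)%:~R * side k[%classic (x ord0 j)].
Proof.
apply/seteqP; split=> x /=.
  by move=> /dyadicP h j _; rewrite /= in_itv /=; exact: h.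
by move=> h; apply/dyadicP => j; have := h j Logic.I; rewrite /= in_itv.
Qed.

Lemma measurable_dyadic_borel k z : measurable (dyadic k @^-1` [set z] : set 'rV[R]_n).
Proof.
rewrite dyadic_fibreE; apply: fin_bigcap_measurable => // j _.
have := @measurable_coor R n j measurableT
  `[(z ord0 j)%:~R * side k, (z ord0 j + 1)%:~R * side k[%classic (measurable_itv _).
by rewrite setTI.
Qed.

Lemma measurable_dyadic k z :
  measurable (dyadic k @^-1` [set z] : set (lebesgue_space R n)).
Proof. by apply: borel_lebesgue_measurable; exact: measurable_dyadic_borel. Qed.

Lemma lebesgue_dyadic k z : leb (dyadic k @^-1` [set z]) = (side k ^+ n)%:E.
Proof.
have mQ := measurable_dyadic_borel k z.
rewrite lebesgue_rVE// -[dyadic k @^-1` _]setIT -integral_indic//.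
pose b (j : 'I_n) : R -> R :=
  \1_(`[(z ord0 j)%:~R * side k, (z ord0 j + 1)%:~R * side k[%classic).
transitivity (\int[borel_lebesgue R n]_x (\prod_j b j (x ord0 j))%:E)%E.
  apply: eq_integral => x _; congr EFin; rewrite indicE.
  have [|] := boolP (x \in _).
    rewrite inE dyadic_fibreE => h.
    rewrite big1// => j _; rewrite /b indicE mem_set//; exact: h.
  rewrite notin_setE dyadic_fibreE => h.
  have [j hj] : exists j, ~ `[(z ord0 j)%:~R * side k, (z ord0 j + 1)%:~R * side k[%classic (x ord0 j).
    by apply/existsNP => h'; apply: h => j _; exact: h'.
  by rewrite (bigD1 j)//= /b indicE memNset// mul0r.
rewrite (@borel_lebesgue_prod _ _ _ (fun=> side k)).
- by rewrite prodr_const card_ord.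
- by move=> j x; rewrite /b indicE.
- by move=> j; exact: measurable_indic.
- move=> j; rewrite integral_indic//= setIT lebesgue_measure_itv /= lte_fin.
  rewrite ltr_pM2r ?side_gt0// ltr_int ltzD1 lexx -EFinB; congr EFin.
  by rewrite -mulrBl -intrB addrAC subrr add0r mul1r.
Qed.

Lemma side_cvg0 (e : R) : 0 < e -> \forall k \near \oo, side k < e.
Proof.
move=> e0; near=> k; rewrite /side -div1r.
by near: k; exact: near_infty_natSinv_expn_lt (PosNum e0).
Unshelve. all: by end_near. Qed.

Lemma dyadic_corner_near k (x : 'rV[R]_n) j :
  `|x ord0 j - (dyadic k x ord0 j)%:~R * side k| <= side k.
Proof.
have /dyadicP/(_ j)/andP[xl xr] := erefl (dyadic k x).
rewrite ger0_norm ?subr_ge0// lerBlDr (le_trans (ltW xr))//.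
by rewrite intrD mulrDl mul1r addrC.
Qed.

(** Each coordinate is the pointwise limit of the corresponding coordinate of the
    lower corner of the cube, which is constant on cubes. *)
Lemma dyadic_generates (A : set 'rV[R]_n) : measurable A ->
  <<s [set E | exists N, saturated dyadic N E] >> A.
Proof.
set G := (X in <<s X >>); pose T := g_sigma_algebraType G.
pose f : T -> 'rV[R]_n := fun x => x.
suff mf : measurable_fun [set: T] f by move=> mA; have := mf measurableT A mA; rewrite setTI.
apply: measurable_fun_coorP => i.
apply: (@measurable_fun_cvg _ _ _ _ (fun k (x : T) => (dyadic k x ord0 i)%:~R * side k : R)).
  move=> k _ Y _; rewrite setTI; apply: sub_sigma_algebra; exists k => x y xy.
  by rewrite /preimage /= xy.
move=> x _; apply/cvgrPdist_le => e e0.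
have := side_cvg0 e0; apply: filterS => k ke.
by rewrite (le_trans (dyadic_corner_near _ _ _))// ltW.
Qed.

Definition window (m : nat) : set 'rV[R]_n :=
  [set x | forall j, (- m%:Z <= dyadic 0 x ord0 j < m%:Z)%R].

Lemma dyadic_integrable_L1_approximable (u : 'rV[R]_n -> R) :
  leb.-integrable setT (EFin \o u) -> L1_approximable leb dyadic u.
Proof.
move: u; apply: (@integrable_L1_approximable R _ (lebesgue_space R n) leb
  'rV[int]_n dyadic dyadic_refine measurable_dyadic window).
- by move=> m x y xy h j; rewrite -xy; exact: h.
- move=> m; rewrite (@le_lt_trans _ _ (leb (@sup_box R n m%:R)))//.
    apply: le_outer_measure => x h j; have /andP[h1 h2] := h j.
    have /dyadicP/(_ j)/andP[] := erefl (dyadic 0 x).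
    rewrite /side expr0 invr1 !mulr1 => xl xr; rewrite ler_norml; apply/andP; split.
      by apply: le_trans xl; rewrite -[- m%:R]/(- (m%:Z%:~R)) -intrN ler_int.
    by apply: ltW; apply: lt_le_trans xr _; rewrite -[m%:R]/(m%:Z%:~R) ler_int lezD1.
  rewrite lebesgue_rVE; first exact: borel_lebesgue_sup_box.
  exact: measurable_sup_box.
- move=> a b ab; apply/subsetPset => x h j; have /andP[h1 h2] := h j.
  have : (a%:Z <= b%:Z)%R by rewrite lez_nat.
  by move=> ab'; apply/andP; split; lia.
- apply/seteqP; split => // x _.
  exists (\sum_j `|dyadic 0 x ord0 j|%N).+1 => // j.
  have : (`|dyadic 0 x ord0 j| <= \sum_j `|dyadic 0 x ord0 j|)%N by rewrite (bigD1 j)//= leq_addr.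
  lia.
- move=> A e _ Afin e0; have [B [mB AB hB]] := lebesgue_rV_outer_regular Afin e0.
  by exists B; split => //; exact: dyadic_generates.
Qed.

End dyadic_cubes.

(** * A smooth bump on the line *)

Section smooth_bump.
Context {R : realType}.
Implicit Types (h : R -> R).

(** Mirrors [Ck] for functions of one variable. *)
Fixpoint smooth_upto (k : nat) h : Prop :=
  match k with
  | 0 => continuous h
  | k'.+1 => (forall x, derivable h x 1) /\ smooth_upto k' (derive1 h)
  end.

Lemma is_derive_continuous h h' : (forall x : R, is_derive x 1 h (h' x)) -> continuous h.
Proof. by move=> dh x; apply/differentiable_continuous/derivable1_diffP; case: (dh x). Qed.

Lemma smooth_uptoS k h h' : (forall x : R, is_derive x 1 h (h' x)) ->
  smooth_upto k h' -> smooth_upto k.+1 h.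
Proof.
move=> dh sh'; split; first by move=> x; case: (dh x).
rewrite (_ : (derive1 h) = h')//; apply/funext => x.
by rewrite derive1E; case: (dh x).
Qed.

Lemma smooth_uptoZD k (c : R) h1 h2 : smooth_upto k h1 -> smooth_upto k h2 ->
  smooth_upto k (fun x => c * h1 x + h2 x).
Proof.
elim: k h1 h2 => [h1 h2 c1 c2 x|k IH h1 h2 [d1 s1] [d2 s2]].
  apply: (@continuousD _ _ _ (fun x => c * h1 x) h2); last exact: c2.
  by apply: continuousM; [exact: cvg_cst|exact: c1].
apply: (@smooth_uptoS _ _ (fun x => c * derive1 h1 x + derive1 h2 x)); last exact: IH.
move=> x; rewrite !derive1E.
have i1 : is_derive x 1 h1 ('D_1 h1 x) by exact: DeriveDef.
have i2 : is_derive x 1 h2 ('D_1 h2 x) by exact: DeriveDef.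
exact: (is_deriveD (is_deriveZ c i1) i2).
Qed.

(** The functions t^-m exp(-1/t) for t > 0, extended by 0.  They are kept for all
    [m] at once because their span is stable under differentiation. *)
Definition expinv (m : nat) (t : R) : R :=
  if 0 < t then t ^- m * expR (- t^-1) else 0.

Lemma expinv_ge0 m t : 0 <= expinv m t.
Proof.
rewrite /expinv; case: ifP => // t0.
by rewrite mulr_ge0 ?expR_ge0// invr_ge0 exprn_ge0// ltW.
Qed.

Lemma expinv_le m t : expinv m t <= m`!%:R.
Proof.
rewrite /expinv; case: ifP => [t0|_]; last by rewrite ler0n.
have s0 : 0 < t^-1 by rewrite invr_gt0.
rewrite -exprVn expRN ler_pdivrMr ?expR_gt0//.
case: m => [|m].
  by rewrite expr0 fact0 mul1r -expR0 ler_expR ltW.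
have := expR_ge1Dxn m (ltW s0).
have f0 : (0 : R) < m.+1`!%:R by rewrite ltr0n fact_gt0.
move=> h; rewrite mulrC -ler_pdivrMr//; apply: le_trans h.
by rewrite lerDr.
Qed.

Lemma expinvS m t : expinv m t = t * expinv m.+1 t.
Proof.
rewrite /expinv; case: ifP => t0; last by rewrite mulr0.
by rewrite mulrA; congr (_ * _); rewrite exprSr; field; rewrite gt_eqF//= gt_eqF// exprn_gt0.
Qed.

(** At the origin the difference quotient of [expinv m] is [expinv m.+1], which is
    bounded by a multiple of |t| since exp dominates every power. *)
Lemma is_derive_expinv m (t : R) :
  is_derive t (1 : R) (expinv m) (expinv m.+2 t - m%:R * expinv m.+1 t).
Proof.
have [t0|t0|t0] := ltrgtP t 0.
- rewrite /expinv !(lt_gtF t0) mulr0 subr0.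
  apply: (@near_eq_is_derive R R R (cst 0)).
  near=> x; rewrite ltNge ltW//=.
  by near: x; exact: lt_nbhsl.
- rewrite /expinv t0.
  have tn0 : t != 0 by rewrite gt_eqF.
  apply: (@near_eq_is_derive R R R (fun x : R => x ^- m * expR (- x^-1))).
    near=> x; rewrite ifT//.
    by near: x; exact: lt_nbhsr.
  have dV : is_derive t (1 : R) (fun x : R => x^-1) (- t ^- 2).
    have := @is_deriveV R id t 1 1 tn0 (is_derive_id _ _).
    by rewrite /GRing.scale /= mulr1.
  have dX : is_derive t (1 : R) (fun x : R => x ^- m) (m%:R * (t^-1) ^+ m.-1 * - t ^- 2).
    have -> : (fun x : R => x ^- m) = (fun x : R => x^-1) ^+ m.
      by apply/funext => x; rewrite exprfctE exprVn.
    exact: is_deriveX.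
  have dN : is_derive t (1 : R) (fun x : R => - x^-1) (t ^- 2).
    by rewrite -[t ^- 2]opprK; exact: is_deriveN.
  have dE : is_derive t (1 : R) (fun x : R => expR (- x^-1)) (expR (- t^-1) * t ^- 2).
    exact: (@is_derive1_comp R expR (fun x : R => - x^-1)).
  apply: (@is_derive_eq _ _ _ _ _ _ _ _ (is_deriveM dX dE)).
  rewrite /GRing.scale /=.
  case: m {dX} => [|m] /=.
    by rewrite expr0 !mul0r mulr0 addr0 subr0 invr1 mul1r mulrC.
  rewrite -!exprVn !exprS; ring.
- subst t; rewrite /expinv ltxx mulr0 subr0 -/(expinv m).
  have H : h^-1 *: (expinv m (h *: 1 + 0) - expinv m 0) @[h --> 0^'] --> (0 : R).
    apply/cvgr0Pnorm_le => e e0.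
    have f0 : (0 : R) < m.+2`!%:R by rewrite ltr0n fact_gt0.
    near=> h.
    have hn0 : h != 0 by near: h; exact: nbhs_dnbhs_neq.
    rewrite {2}/expinv ltxx subr0 addr0 [h *: 1]mulr1 /GRing.scale /=.
    rewrite expinvS mulrA mulVf// mul1r expinvS normrM (ger0_norm (expinv_ge0 _ _)).
    rewrite (le_trans (ler_wpM2l _ (expinv_le _ _)))// -ler_pdivlMr//.
    near: h; apply: dnbhs0_le; exact: divr_gt0.
  split; first by apply/cvg_ex; exists 0.
  exact: cvg_lim H.
Unshelve. all: by end_near. Qed.

Section profile.
Variables (l w : R).
Hypothesis w0 : 0 < w.

(** A product of two one-sided profiles facing each other, supported in the segment
    from [l] to [l + 2 w].  The indices make the span of these products
    stable under differentiation. *)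
Definition profile (i j : nat) (x : R) : R :=
  expinv i ((x - l) / w) * expinv j (2 - (x - l) / w).

Lemma profile_ge0 i j x : 0 <= profile i j x.
Proof. by rewrite mulr_ge0 ?expinv_ge0. Qed.

Lemma profile_le i j x : profile i j x <= i`!%:R * j`!%:R.
Proof. by rewrite ler_pM ?expinv_ge0 ?expinv_le. Qed.

Lemma profile_supp i j x : ~~ (l < x < l + 2 * w) -> profile i j x = 0.
Proof.
rewrite negb_and -!leNgt /profile /expinv => /orP[xl|xr].
  by rewrite ifF ?mul0r// ltNge pmulr_lle0 ?invr_gt0// subr_le0 xl.
rewrite [X in _ * X]ifF ?mulr0// subr_gt0 ltr_pdivrMr//.
by rewrite ltrBlDl ltNge xr.
Qed.

Definition profile' (i j : nat) (x : R) : R :=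
  w^-1 * ((profile i.+2 j x - i%:R * profile i.+1 j x) -
          (profile i j.+2 x - j%:R * profile i j.+1 x)).

Lemma is_derive_profile i j (x : R) :
  is_derive x (1 : R) (profile i j) (profile' i j x).
Proof.
have d1 : is_derive x (1 : R) (fun x : R => (x - l) / w) w^-1.
  have -> : (fun x : R => (x - l) / w) = w^-1 \*: (id - cst l) :> (R -> R).
    by apply/funext => y; rewrite /= mulrC.
  apply: is_derive_eq.
  by rewrite subr0 /GRing.scale /= mulr1.
have d2 : is_derive x (1 : R) (fun x : R => 2 - (x - l) / w) (- w^-1).
  have -> : (fun x : R => 2 - (x - l) / w) = cst 2 - (fun x : R => (x - l) / w) :> (R -> R).
    by apply/funext => y.
  apply: is_derive_eq.
  by rewrite sub0r.
have e1 := @is_derive1_comp R (expinv i) _ x _ _ (is_derive_expinv _ _) d1.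
have e2 := @is_derive1_comp R (expinv j) _ x _ _ (is_derive_expinv _ _) d2.
apply: (@is_derive_eq _ _ _ _ _ _ _ _ (is_deriveM e1 e2)).
by rewrite /profile' /profile /GRing.scale /=; ring.
Qed.

Lemma smooth_profile k i j : smooth_upto k (profile i j).
Proof.
elim: k i j => [|k IH] i j.
  exact: is_derive_continuous (is_derive_profile i j).
apply: (smooth_uptoS (is_derive_profile i j)).
pose c := w^-1.
have -> : profile' i j = fun x => c * profile i.+2 j x +
   (- (i%:R * c) * profile i.+1 j x + (- c * profile i j.+2 x +
     ((j%:R * c - 1) * profile i j.+1 x + profile i j.+1 x))).
  by apply/funext => x; rewrite /profile' /c; ring.
by do 4 (apply: smooth_uptoZD => //).
Qed.

Lemma measurable_profile i j : measurable_fun setT (profile i j).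
Proof.
apply: continuous_measurable_fun; exact: is_derive_continuous (is_derive_profile i j).
Qed.

(** A lower bound for the profile on the middle half of its support, independent of
    the scale; it makes the estimates on the normalised bump scale correctly. *)
Definition bump_ratio : R := expR (- 2) * expR (- 2).

Lemma bump_ratio_gt0 : 0 < bump_ratio.
Proof. by rewrite mulr_gt0 ?expR_gt0. Qed.

Lemma profile_lower x : l + w / 2 <= x <= l + w / 2 + w -> bump_ratio <= profile 0 0 x.
Proof.
move=> /andP[xl xr].
have t1 : 2^-1 <= (x - l) / w by rewrite ler_pdivlMr// mulrC lerBrDl.
have t2 : 2^-1 <= 2 - (x - l) / w.
  rewrite lerBrDl -lerBrDr ler_pdivrMr//.
  have -> : (2 - 2^-1) * w = w / 2 + w by field.
  by rewrite lerBlDl addrA.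
have low (t : R) : 2^-1 <= t -> expR (- 2) <= expinv 0 t.
  move=> t2'; have t0 : 0 < t by apply: lt_le_trans t2'; rewrite invr_gt0.
  rewrite /expinv t0 expr0 invr1 mul1r ler_expR lerN2.
  by rewrite -[leRHS]invrK lef_pV2// posrE invr_gt0.
by apply: ler_pM; rewrite ?expR_ge0 ?low.
Qed.

Definition mass : R := \int[lebesgue_measure]_x profile 0 0 x.

Lemma integral_segment (f : R -> R) : (forall x, ~~ (l < x < l + 2 * w) -> f x = 0) ->
  (\int[lebesgue_measure]_x (f x)%:E =
   \int[lebesgue_measure]_(x in `[l, (l + 2 * w)%R]) (f x)%:E)%E.
Proof.
move=> fs; rewrite [RHS]integral_mkcond; apply: eq_integral => x _.
rewrite patchE; case: ifPn => //; rewrite notin_setE /= in_itv /= => h.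
by rewrite fs//; apply/negP => /andP[h1 h2]; apply: h; rewrite !ltW.
Qed.

Lemma lebesgue_segment a b : a <= b -> lebesgue_measure `[a, b]%classic = (b - a)%:E :> \bar R.
Proof.
rewrite le_eqVlt => /predU1P[<-|ab].
  by rewrite lebesgue_measure_itv /= ltxx subrr.
by rewrite lebesgue_measure_itv /= lte_fin ab -EFinB.
Qed.

Lemma mass_fin : (\int[lebesgue_measure]_x (profile 0 0 x)%:E = mass%:E)%E.
Proof.
rewrite /mass /Rintegral fineK//.
rewrite ge0_fin_numE; last by apply: integral_ge0 => x _; rewrite lee_fin profile_ge0.
rewrite integral_segment; last by move=> x; exact: profile_supp.
apply: (@le_lt_trans _ _ (\int[lebesgue_measure]_(x in `[l, (l + 2 * w)%R]) (1%:E : \bar R))%E).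
  apply: ge0_le_integral => //.
  - by move=> x _; rewrite lee_fin profile_ge0.
  - by apply/measurable_EFinP/measurable_funTS; exact: measurable_profile.
  - by move=> x _; rewrite lee_fin (le_trans (profile_le _ _ _))// fact0 mul1r.
rewrite integral_cst//= mul1e lebesgue_segment ?ltry//.
by rewrite lerDl mulr_ge0// ltW.
Qed.

Lemma mass_ge : bump_ratio * w <= mass.
Proof.
rewrite -lee_fin -mass_fin.
have -> : (bump_ratio * w)%:E = (\int[lebesgue_measure]_(x in `[(l + w / 2)%R, (l + w / 2 + w)%R]) (bump_ratio%:E : \bar R))%E.
  rewrite integral_cst//= lebesgue_segment; last by rewrite lerDl ltW.
  by rewrite -EFinM; congr (_ * _)%:E; ring.
rewrite [leLHS]integral_mkcond; apply: ge0_le_integral => //.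
- by move=> x _; rewrite patchE; case: ifP => _ //; rewrite lee_fin ltW// bump_ratio_gt0.
- by apply/(measurable_restrictT _ _).1 => //; exact: measurable_cst.
- by apply/measurable_EFinP; exact: measurable_profile.
move=> x _; rewrite patchE; case: ifPn => [|_]; last by rewrite lee_fin profile_ge0.
by rewrite inE /= in_itv /= => h; rewrite lee_fin profile_lower.
Qed.

Lemma mass_gt0 : 0 < mass.
Proof. by apply: lt_le_trans mass_ge; rewrite mulr_gt0// bump_ratio_gt0. Qed.

Definition bump x : R := mass^-1 * profile 0 0 x.
Definition bump' x : R := mass^-1 * profile' 0 0 x.

Lemma is_derive_bump (x : R) : is_derive x (1 : R) bump (bump' x).
Proof. exact: (is_deriveZ mass^-1 (is_derive_profile 0 0 x)). Qed.

Lemma smooth_bump k : smooth_upto k bump.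
Proof.
have -> : bump = fun x => (mass^-1 - 1) * profile 0 0 x + profile 0 0 x.
  by apply/funext => x; rewrite /bump; ring.
by apply: smooth_uptoZD; exact: smooth_profile.
Qed.

Lemma bump_ge0 x : 0 <= bump x.
Proof. by rewrite mulr_ge0 ?profile_ge0// invr_ge0 ltW// mass_gt0. Qed.

Lemma mass_inv_le : mass^-1 <= bump_ratio^-1 / w.
Proof.
by rewrite -invfM lef_pV2 ?posrE ?mass_gt0 ?mulr_gt0 ?bump_ratio_gt0// mulrC [w * _]mulrC mass_ge.
Qed.

Lemma bump_le x : bump x <= bump_ratio^-1 / w.
Proof.
apply: le_trans mass_inv_le; rewrite ler_piMr ?invr_ge0 ?(ltW mass_gt0)//.
by rewrite (le_trans (profile_le _ _ _))// fact0 mul1r.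
Qed.

Lemma bump'_le x : `|bump' x| <= 2 * bump_ratio^-1 / w ^+ 2.
Proof.
rewrite normrM ger0_norm ?invr_ge0 ?(ltW mass_gt0)//.
have -> : 2 * bump_ratio^-1 / w ^+ 2 = bump_ratio^-1 / w * (w^-1 * 2).
  by field; rewrite !gt_eqF// bump_ratio_gt0.
apply: ler_pM; rewrite ?invr_ge0 ?(ltW mass_gt0)// ?mass_inv_le//.
rewrite normrM ger0_norm ?invr_ge0 ?(ltW w0)// ler_pM2l ?invr_gt0//.
rewrite !mul0r !subr0.
have := profile_ge0 2 0 x; have := profile_ge0 0 2 x.
have := profile_le 2 0 x; have := profile_le 0 2 x.
rewrite fact0 mulr1 mul1r !factS fact0 !muln1 => *; rewrite ler_norml; lra.
Qed.

Lemma bump_supp x : ~~ (l < x < l + 2 * w) -> bump x = 0.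
Proof. by move=> h; rewrite /bump profile_supp ?mulr0. Qed.

Lemma bump'_supp x : ~~ (l < x < l + 2 * w) -> bump' x = 0.
Proof. by move=> h; rewrite /bump' /profile' !profile_supp// !(mulr0, subrr). Qed.

Lemma continuous_bump : continuous bump.
Proof. exact: is_derive_continuous is_derive_bump. Qed.

Lemma continuous_bump' : continuous bump'.
Proof.
have := smooth_bump 1; rewrite /= => -[_].
rewrite (_ : derive1 bump = bump')//; apply/funext => x.
by rewrite derive1E; case: (is_derive_bump x).
Qed.

Lemma measurable_bump : measurable_fun setT bump.
Proof. exact: continuous_measurable_fun continuous_bump. Qed.

Lemma measurable_bump' : measurable_fun setT bump'.
Proof. exact: continuous_measurable_fun continuous_bump'. Qed.

Lemma integral_bump : (\int[lebesgue_measure]_x (bump x)%:E = 1)%E.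
Proof.
under eq_integral do rewrite EFinM.
rewrite ge0_integralZl//; last 3 first.
- by apply/measurable_EFinP; exact: measurable_profile.
- by move=> x _; rewrite lee_fin profile_ge0.
- by rewrite lee_fin invr_ge0 ltW// mass_gt0.
by rewrite mass_fin -EFinM mulVf// gt_eqF// mass_gt0.
Qed.

Definition bump'_pos x : R := Num.max (bump' x) 0.
Definition bump'_neg x : R := Num.max (- bump' x) 0.
Definition bump'_mass : R := \int[lebesgue_measure]_x bump'_pos x.

(** The derivative of a compactly supported function has mean zero.  The
    statement is split into positive and negative parts because [borel_lebesgue_prod]
    concerns nonnegative factors. *)
Lemma integral_bump'_pos_neg :
  (\int[lebesgue_measure]_x (bump'_pos x)%:E = bump'_mass%:E /\
   \int[lebesgue_measure]_x (bump'_neg x)%:E = bump'_mass%:E)%E.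
Proof.
have cw : {within `[l, (l + 2 * w)%R], continuous bump'}.
  by apply: continuous_subspaceT; exact: continuous_bump'.
have lr : l < l + 2 * w by rewrite ltrDl mulr_gt0.
have i' : lebesgue_measure.-integrable `[l, (l + 2 * w)%R] (EFin \o bump').
  by apply: continuous_compact_integrable => //; exact: segment_compact.
have ii : (\int[lebesgue_measure]_(x in `[l, (l + 2 * w)%R]) (bump' x)%:E = 0)%E.
  rewrite (@continuous_FTC2 _ _ bump _ _ lr cw).
  - by rewrite !bump_supp ?subee// ?ltxx ?andbF.
  - split.
    + by move=> x _; case: (is_derive_bump x).
    + by apply: cvg_at_right_filter; exact: continuous_bump.
    + by apply: cvg_at_left_filter; exact: continuous_bump.
  - by move=> x _; rewrite derive1E; case: (is_derive_bump x).
have pE : (\int[lebesgue_measure]_x (bump'_pos x)%:E =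
  \int[lebesgue_measure]_(x in `[l, (l + 2 * w)%R]) (EFin \o bump')^\+ x)%E.
  rewrite integral_segment; last by move=> x h; rewrite /bump'_pos bump'_supp// maxxx.
  by apply: eq_integral => x _; rewrite funeposE /= EFin_max.
have nE : (\int[lebesgue_measure]_x (bump'_neg x)%:E =
  \int[lebesgue_measure]_(x in `[l, (l + 2 * w)%R]) (EFin \o bump')^\- x)%E.
  rewrite integral_segment; last by move=> x h; rewrite /bump'_neg bump'_supp// oppr0 maxxx.
  by apply: eq_integral => x _; rewrite funenegE /= EFin_max.
have mI : measurable (`[l, (l + 2 * w)%R]%classic : set (measurableTypeR R)).
  exact: measurable_itv.
have fp := integrable_pos_fin_num mI i'.
have fn := integrable_neg_fin_num mI i'.
have pm : (\int[lebesgue_measure]_x (bump'_pos x)%:E = bump'_mass%:E)%E.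
  by rewrite /bump'_mass /Rintegral fineK// pE.
split => //; rewrite -pm pE nE; move: ii; rewrite integralE.
by move/eqP; rewrite sube_eq ?add0e ?fin_num_adde_defl// => /eqP ->.
Qed.

End profile.

End smooth_bump.

(** * Kernels carried by dyadic cubes *)

Section product_test_function.
Context {R : realType} {n : nat}.
Implicit Types (b : 'I_n -> R -> R).

Definition coor_prod b (x : 'rV[R]_n) : R := \prod_j b j (x ord0 j).

(** Differentiating a product of functions of separate variables in direction [i]
    changes the [i]th factor only, so these products are stable under [partial]. *)
Definition derive_factor (i : 'I_n) b (j : 'I_n) : R -> R :=
  if j == i then derive1 (b j) else b j.

Lemma continuous_coor_prod b : (forall j, continuous (b j)) -> continuous (coor_prod b).
Proof.
move=> cb; rewrite /coor_prod; elim: (index_enum _) => [|j s IH].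
  rewrite [X in continuous X](_ : _ = cst 1); first exact: cst_continuous.
  by apply/funext => x; rewrite big_nil.
rewrite [X in continuous X](_ : _ =
    (fun x : 'rV[R]_n => b j (x ord0 j)) \* (fun x : 'rV[R]_n => \prod_(j <- s) b j (x ord0 j))); last first.
  by apply/funext => x; rewrite big_cons.
move=> x; apply: continuousM; last exact: IH.
apply: (@continuous_comp _ _ _ (fun y : 'rV[R]_n => y ord0 j) (b j)); last exact: cb.
exact: coord_continuous.
Qed.

Lemma is_derive_coor_prod b i (x : 'rV[R]_n) : (forall y, derivable (b i) y 1) ->
  is_derive x (delta_mx ord0 i) (coor_prod b) (coor_prod (derive_factor i b) x).
Proof.
move=> db; pose P := \prod_(j | j != i) b j (x ord0 j).
have -> : coor_prod (derive_factor i b) x = derive1 (b i) (x ord0 i) * P.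
  rewrite /coor_prod (bigD1 i)//= /derive_factor eqxx; congr (_ * _).
  by apply: eq_bigr => j /negbTE ->.
have H : h^-1 *: (coor_prod b (h *: delta_mx ord0 i + x) - coor_prod b x) @[h --> 0^'] -->
    derive1 (b i) (x ord0 i) * P.
  have -> : (fun h : R => h^-1 *: (coor_prod b (h *: delta_mx ord0 i + x) - coor_prod b x)) =
      (fun h : R => (h^-1 *: (b i (h *: 1 + x ord0 i) - b i (x ord0 i))) * P).
    apply/funext => h; rewrite /coor_prod (bigD1 i)//= [in X in _ - X](bigD1 i)//=.
    have -> : \prod_(j < n | j != i) b j ((h *: delta_mx ord0 i + x) ord0 j) = P.
      apply: eq_bigr => j ji; rewrite !mxE eqxx (negbTE ji) /=.
      by rewrite mulr0 add0r.
    by rewrite !mxE !eqxx /= -mulrBl /GRing.scale /= mulrA.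
  apply: cvgMl; rewrite derive1E; exact: (db (x ord0 i)).
split; first by apply/cvg_ex; exists (derive1 (b i) (x ord0 i) * P).
exact: cvg_lim H.
Qed.

Lemma partial_coor_prod b i : (forall y, derivable (b i) y 1) ->
  partial i (coor_prod b) = coor_prod (derive_factor i b).
Proof.
by move=> db; apply/funext => x; case: (is_derive_coor_prod x db).
Qed.

(** Induction on the order, using that [partial] sends a product of smooth
    functions of one variable to another such product. *)
Lemma Ck_coor_prod k b : (forall m j, smooth_upto m (b j)) -> Ck k (coor_prod b).
Proof.
elim: k b => [|k IH] b sb.
  by apply: continuous_coor_prod => j; exact: (sb 0%N j).
split; first by apply: continuous_coor_prod => j; exact: (sb 0%N j).
move=> i; have db : forall y, derivable (b i) y 1 by case: (sb 1%N i).
split=> [x|]; first by case: (is_derive_coor_prod x db).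
rewrite partial_coor_prod//; apply: IH => m j; rewrite /derive_factor.
by case: ifP => _; [case: (sb m.+1 j)|exact: sb].
Qed.

Definition closed_box (l r : 'I_n -> R) : set 'rV[R]_n :=
  [set x | forall j, `[l j, r j]%classic (x ord0 j)].

Lemma compact_closed_box l r : compact (closed_box l r).
Proof.
apply: (@rV_compact R n (fun j => `[l j, r j]%classic)) => j.
exact: segment_compact.
Qed.

Lemma test_function_coor_prod (Omega : set 'rV[R]_n) b l r :
  (forall m j, smooth_upto m (b j)) ->
  (forall j t, ~~ (l j < t < r j) -> b j t = 0) ->
  closed_box l r `<=` Omega -> test_function Omega (coor_prod b).
Proof.
move=> sb bs boxO.
have cb : closed (closed_box l r).
  apply: compact_closed; [exact: norm_hausdorff|exact: compact_closed_box].
have sub : closure [set x | coor_prod b x != 0] `<=` closed_box l r.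
  rewrite [X in _ `<=` X](_ : _ = closure (closed_box l r)); last exact/closure_id.
  apply: closure_subset => x /= nz j.
  rewrite /= in_itv /=; apply: contraT => h; move: nz.
  rewrite /coor_prod (bigD1 j)//= bs ?mul0r ?eqxx//.
  by apply: contra h => /andP[h1 h2]; rewrite !ltW.
split.
- by move=> k; exact: Ck_coor_prod.
- by apply: subclosed_compact sub; [exact: closed_closure|exact: compact_closed_box].
- exact: subset_trans boxO.
Qed.

Local Open Scope ereal_scope.

Lemma measurable_coor_prod b :
  (forall j, measurable_fun setT (b j : measurableTypeR R -> measurableTypeR R)) ->
  measurable_fun [set: 'rV[R]_n] (coor_prod b).
Proof.
move=> mb; apply: measurable_prod => j _; exact: measurable_fun_rV_coor.
Qed.

Lemma integral_coor_prod b (I : 'I_n -> R) :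
  (forall i x, 0 <= b i x)%R ->
  (forall i, measurable_fun setT (b i : measurableTypeR R -> measurableTypeR R)) ->
  (forall i, \int[lebesgue_measure]_x (b i x)%:E = (I i)%:E) ->
  \int[lebesgue_rV R n]_x (coor_prod b x)%:E = (\prod_i I i)%:E.
Proof.
move=> b0 mb Ib; rewrite ge0_integral_lebesgue_rV.
- exact: borel_lebesgue_prod.
- by apply/measurable_EFinP; exact: measurable_coor_prod.
- by move=> x; rewrite lee_fin prodr_ge0.
Qed.

End product_test_function.

Section cube_kernel.
Context {R : realType} {n : nat}.
Local Notation leb := (lebesgue_rV R n).
Local Notation side := (@side R).

(** Chosen so that the cube of half-width [core_width k] lies in the ball of radius
    [side k / 2]: sqrt n < n + 1. *)
Definition core_width (k : nat) : R := side k / (2 * n.+1%:R).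

Lemma core_width_gt0 k : 0 < core_width k.
Proof. by rewrite divr_gt0 ?side_gt0// mulr_gt0. Qed.

Definition cube_center (k : nat) (z : 'rV[int]_n) : 'rV[R]_n :=
  \row_j (((z ord0 j)%:~R + 2^-1) * side k).

Definition core_left k z (j : 'I_n) : R := cube_center k z ord0 j - core_width k.

Definition kernel_factor k z (j : 'I_n) : R -> R := bump (core_left k z j) (core_width k).

Definition cube_kernel (k : nat) (z : 'rV[int]_n) : 'rV[R]_n -> R :=
  coor_prod (kernel_factor k z).

Definition core k z : set 'rV[R]_n :=
  closed_box (core_left k z) (fun j => core_left k z j + 2 * core_width k).

Lemma enorm_coor (x : 'rV[R]_n) j : `|x ord0 j| <= enorm x.
Proof.
rewrite -sqrtr_sqr ler_sqrt; last by apply: sumr_ge0 => i _; exact: sqr_ge0.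
by rewrite (bigD1 j)//= lerDl sumr_ge0// => i _; exact: sqr_ge0.
Qed.

(** The Euclidean norm on the core is at most sqrt n times its half-width. *)
Lemma core_sub_ball k z : core k z `<=` eball (cube_center k z) (side k / 2).
Proof.
move=> x h; rewrite /eball /= /enorm.
have s0 := side_gt0 (R := R) k; have w0 := core_width_gt0 k.
have -> : side k / 2 = Num.sqrt ((n.+1%:R * core_width k) ^+ 2).
  rewrite sqrtr_sqr ger0_norm; last by rewrite mulr_ge0 ?ltW.
  by rewrite /core_width; field; rewrite ?nat1r ?natr1 pnatr_eq0.
rewrite ltr_sqrt; last by rewrite exprn_gt0// mulr_gt0.
apply: (@le_lt_trans _ _ (\sum_(j < n) core_width k ^+ 2)).
  apply: ler_sum => j _; rewrite -[leLHS]real_normK ?num_real// ler_pXn2r ?nnegrE ?(ltW w0)//.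
  have := h j; rewrite /= in_itv /= /core_left => /andP[h1 h2].
  rewrite !mxE ler_norml; move: h1 h2; rewrite !mxE => h1 h2; lra.
rewrite sumr_const card_ord -[_ *+ n]mulr_natl [in ltRHS]exprMn ltr_pM2r ?exprn_gt0//.
rewrite -natrX ltr_nat; apply: (@leq_trans n.+1) => //.
by rewrite expnS leq_pmulr.
Qed.

Lemma ball_sub_cube k z :
  eball (cube_center k z) (side k / 2) `<=` dyadic k @^-1` [set z].
Proof.
move=> x; rewrite /eball /= => h; apply/dyadicP => j.
have := le_lt_trans (enorm_coor _ j) h; rewrite !mxE ltr_norml => /andP[h1 h2].
rewrite intrD; apply/andP; split; lra.
Qed.

Lemma smooth_kernel_factor k z m j : smooth_upto m (kernel_factor k z j).
Proof. exact: smooth_bump. Qed.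

Lemma kernel_factor_supp k z j t :
  ~~ (core_left k z j < t < core_left k z j + 2 * core_width k) -> kernel_factor k z j t = 0.
Proof. by move=> h; apply: bump_supp => //; exact: core_width_gt0. Qed.

Lemma test_function_cube_kernel (Omega : set 'rV[R]_n) k z :
  core k z `<=` Omega -> test_function Omega (cube_kernel k z).
Proof.
apply: test_function_coor_prod; first exact: smooth_kernel_factor.
exact: kernel_factor_supp.
Qed.

Lemma cube_kernel_ge0 k z x : 0 <= cube_kernel k z x.
Proof. by apply: prodr_ge0 => j _; apply: bump_ge0; exact: core_width_gt0. Qed.

Lemma coor_prod_supp (b : 'I_n -> R -> R) k z x :
  (forall j t, ~~ (core_left k z j < t < core_left k z j + 2 * core_width k) -> b j t = 0) ->
  ~ core k z x -> coor_prod b x = 0.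
Proof.
move=> bs /existsNP[j nj]; rewrite /coor_prod (bigD1 j)//= bs ?mul0r//.
by apply/negP => /andP[h1 h2]; apply: nj; rewrite /= in_itv /= !ltW.
Qed.

Lemma cube_kernel_core k z x : ~ core k z x -> cube_kernel k z x = 0.
Proof. by apply: coor_prod_supp => j t; exact: kernel_factor_supp. Qed.

Lemma cube_kernel_supp k z x : dyadic k x != z -> cube_kernel k z x = 0.
Proof.
move=> xz; apply: cube_kernel_core => cx; move/eqP: xz; apply.
exact/ball_sub_cube/core_sub_ball.
Qed.

(** The constant C of the bound phi_Q <= C/|Q|; it does not depend on the level. *)
Definition kernel_bound : R := ((@bump_ratio R)^-1 * (2 * n.+1%:R)) ^+ n.

Lemma kernel_bound_gt0 : 0 < kernel_bound.
Proof. by rewrite exprn_gt0// mulr_gt0 ?invr_gt0 ?bump_ratio_gt0// mulr_gt0. Qed.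

Lemma kernel_boundE k : kernel_bound = side k ^+ n * ((@bump_ratio R)^-1 / core_width k) ^+ n.
Proof.
rewrite -exprMn; congr (_ ^+ _); rewrite /core_width; field.
by rewrite nat1r pnatr_eq0 /= !gt_eqF ?side_gt0 ?bump_ratio_gt0.
Qed.

Lemma cube_kernel_le k z x : side k ^+ n * cube_kernel k z x <= kernel_bound.
Proof.
rewrite (kernel_boundE k) ler_pM2l ?exprn_gt0 ?side_gt0// -[X in _ ^+ X](card_ord n) -prodr_const.
by apply: ler_prod => j _; rewrite bump_ge0 ?bump_le//; exact: core_width_gt0.
Qed.

Lemma measurable_cube_kernel k z : measurable_fun [set: lebesgue_space R n] (cube_kernel k z).
Proof.
apply: borel_lebesgue_measurable_fun; apply: measurable_coor_prod => j.
by apply: measurable_bump; exact: core_width_gt0.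
Qed.

Lemma integral_cube_kernel k z : (\int[leb]_x (cube_kernel k z x)%:E = 1)%E.
Proof.
rewrite (integral_coor_prod (I := fun=> 1)).
- by rewrite big1.
- by move=> i x; apply: bump_ge0; exact: core_width_gt0.
- by move=> j; apply: measurable_bump; exact: core_width_gt0.
- by move=> j; rewrite integral_bump//; exact: core_width_gt0.
Qed.

Section gradient.
Variables (k : nat) (z : 'rV[int]_n) (i : 'I_n).

Definition grad_kernel : 'rV[R]_n -> R := partial i (cube_kernel k z).

Definition replace_factor (c : R -> R) (j : 'I_n) : R -> R :=
  if j == i then c else kernel_factor k z j.

Lemma coor_prod_replace c x : coor_prod (replace_factor c) x =
  c (x ord0 i) * \prod_(j | j != i) kernel_factor k z j (x ord0 j).
Proof.
rewrite /coor_prod (bigD1 i)//= /replace_factor eqxx; congr (_ * _).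
by apply: eq_bigr => j /negbTE ->.
Qed.

Lemma grad_kernelE :
  grad_kernel = coor_prod (replace_factor (bump' (core_left k z i) (core_width k))).
Proof.
have w0 := core_width_gt0 k.
rewrite /grad_kernel partial_coor_prod; last by move=> y; case: (is_derive_bump (core_left k z i) (core_width k) y).
congr coor_prod; apply/funext => j; rewrite /derive_factor /replace_factor.
case: eqP => // ->; apply/funext => y; rewrite derive1E.
by case: (is_derive_bump (core_left k z i) (core_width k) y).
Qed.

Lemma grad_kernel_core x : ~ core k z x -> grad_kernel x = 0.
Proof.
rewrite grad_kernelE; apply: coor_prod_supp => j t h; rewrite /replace_factor.
case: eqP => [ji|_]; last exact: kernel_factor_supp.
by apply: bump'_supp; rewrite -?ji//; exact: core_width_gt0.
Qed.

Lemma grad_kernel_le x : side k ^+ n * `|grad_kernel x| <= kernel_bound * (2 / core_width k).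
Proof.
have w0 := core_width_gt0 k.
rewrite (kernel_boundE k) grad_kernelE -mulrA ler_pM2l ?exprn_gt0 ?side_gt0//.
have -> : ((@bump_ratio R)^-1 / core_width k) ^+ n * (2 / core_width k) =
   (2 * (@bump_ratio R)^-1 / core_width k ^+ 2) * \prod_(j < n | j != i) ((@bump_ratio R)^-1 / core_width k).
  rewrite -[X in _ ^+ X * _](card_ord n) -prodr_const (bigD1 i)//=.
  set P := \prod_(j < n | j != i) _; move: w0; move: (core_width k) P => w P w0.
  by field; rewrite !gt_eqF ?bump_ratio_gt0.
rewrite coor_prod_replace normrM; apply: ler_pM => //.
  exact: bump'_le.
rewrite normr_prod; apply: ler_prod => j _; rewrite normr_ge0 /=.
by rewrite ger0_norm ?bump_ge0 ?bump_le.
Qed.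

Lemma measurable_grad_kernel : measurable_fun [set: lebesgue_space R n] grad_kernel.
Proof.
have w0 := core_width_gt0 k.
rewrite grad_kernelE; apply: borel_lebesgue_measurable_fun; apply: measurable_coor_prod => j.
by rewrite /replace_factor; case: eqP => _; [exact: measurable_bump'|exact: measurable_bump].
Qed.

(** Write the derivative as the difference of two nonnegative products, which differ
    in the factor [i] only and have the same integral there. *)
Lemma integral_grad_kernel : leb.-integrable setT (EFin \o grad_kernel) /\
  \int[leb]_x grad_kernel x = 0.
Proof.
have w0 := core_width_gt0 k.
pose l := core_left k z i; pose w := core_width k.
pose gp := coor_prod (replace_factor (bump'_pos l w)).
pose gn := coor_prod (replace_factor (bump'_neg l w)).
have [Ip In] := integral_bump'_pos_neg l w0.
have mp : measurable_fun setT (bump'_pos l w : measurableTypeR R -> measurableTypeR R).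
  by apply: measurable_maxr => //; exact: measurable_bump'.
have mn : measurable_fun setT (bump'_neg l w : measurableTypeR R -> measurableTypeR R).
  by apply: measurable_maxr => //; apply: measurableT_comp => //; exact: measurable_bump'.
have mm c : measurable_fun setT (c : measurableTypeR R -> measurableTypeR R) ->
    forall j, measurable_fun setT (replace_factor c j : measurableTypeR R -> measurableTypeR R).
  by move=> mc j; rewrite /replace_factor; case: eqP => _ //; exact: measurable_bump.
have pp c : (forall t, 0 <= c t) -> forall j t, 0 <= replace_factor c j t.
  by move=> c0 j t; rewrite /replace_factor; case: eqP => _ //; exact: bump_ge0.
have ii c (J : R) : (\int[lebesgue_measure]_x (c x)%:E = J%:E)%E ->
  forall j, (\int[lebesgue_measure]_x (replace_factor c j x)%:E = (if j == i then J else 1)%:E)%E.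
  by move=> cJ j; rewrite /replace_factor; case: eqP => _ //; exact: integral_bump.
have p0 t : 0 <= bump'_pos l w t by rewrite le_max lexx orbT.
have n0 t : 0 <= bump'_neg l w t by rewrite le_max lexx orbT.
have Igp := integral_coor_prod (pp _ p0) (mm _ mp) (ii _ _ Ip).
have Ign := integral_coor_prod (pp _ n0) (mm _ mn) (ii _ _ In).
have intg c : (forall t, 0 <= c t) -> measurable_fun setT (c : measurableTypeR R -> measurableTypeR R) ->
    (\int[leb]_x (coor_prod (replace_factor c) x)%:E < +oo)%E ->
    leb.-integrable setT (EFin \o coor_prod (replace_factor c)).
  move=> c0 mc h; apply/integrableP; split.
    apply/measurable_EFinP; apply: borel_lebesgue_measurable_fun.
    by apply: measurable_coor_prod; exact: mm.
  apply: le_lt_trans h; rewrite le_eqVlt; apply/orP; left; apply/eqP.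
  apply: eq_integral => x _; rewrite /= ger0_norm//.
  by apply: prodr_ge0 => j _; exact: pp.
have igp : leb.-integrable setT (EFin \o gp) by apply: intg => //; rewrite Igp ltry.
have ign : leb.-integrable setT (EFin \o gn) by apply: intg => //; rewrite Ign ltry.
have gE : grad_kernel = fun x => gp x - gn x.
  apply/funext => x; rewrite grad_kernelE /gp /gn !coor_prod_replace -mulrBl; congr (_ * _).
  rewrite /bump'_pos /bump'_neg -/l -/w; set t := bump' _ _ _.
  by rewrite /Num.max; case: ltP => h1; case: ltP => h2; lra.
rewrite gE; split.
  by have := integrableB measurableT igp ign; apply: eq_integrable => // x _ /=; rewrite EFinB.
by rewrite RintegralB// /Rintegral Igp Ign subrr.
Qed.

End gradient.

End cube_kernel.

(** * Exhaustion of an open set and the gradient estimate on one cube *)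

Section exhaustion.
Context {R : realType} {n : nat}.
Local Notation leb := (lebesgue_rV R n).

Definition closed_cube (kz : nat * 'rV[int]_n) : set 'rV[R]_n :=
  closed_box (fun j => (kz.2 ord0 j)%:~R * @side R kz.1)
             (fun j => (kz.2 ord0 j + 1)%:~R * @side R kz.1).

Lemma dyadic_closed_cube k z : dyadic k @^-1` [set z] `<=` closed_cube (k, z).
Proof.
move=> x /dyadicP h j; have /andP[h1 h2] := h j.
by rewrite /= in_itv /= h1 ltW.
Qed.

Variable Omega : set 'rV[R]_n.

(** An enumeration of the dyadic cubes of all levels whose closure lies in
    [Omega]; closures are required so that finite unions have a compact cover
    inside [Omega]. *)
Definition inner_index (i : nat) : option (nat * 'rV[int]_n) :=
  if pickle_inv i is Some kz then
    if `[< closed_cube kz `<=` Omega >] then Some kz else None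
  else None.

Definition inner_cube i : set 'rV[R]_n :=
  if inner_index i is Some kz then dyadic kz.1 @^-1` [set kz.2] else set0.

Definition inner_closed_cube i : set 'rV[R]_n :=
  if inner_index i is Some kz then closed_cube kz else set0.

Definition exhaustion m : set 'rV[R]_n := \big[setU/set0]_(i < m) inner_cube i.

Definition exhaustion_cover m : set 'rV[R]_n :=
  \big[setU/set0]_(i < m) inner_closed_cube i.

Lemma exhaustion_sub_cover m : exhaustion m `<=` exhaustion_cover m.
Proof.
rewrite /exhaustion /exhaustion_cover -!bigcup_mkord => x [i im Ix]; exists i => //.
move: Ix; rewrite /inner_cube /inner_closed_cube; case: inner_index => // -[k z].
exact: dyadic_closed_cube.
Qed.

Lemma exhaustion_cover_sub m : exhaustion_cover m `<=` Omega.
Proof.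
rewrite /exhaustion_cover -bigcup_mkord => x [i _]; rewrite /inner_closed_cube /inner_index.
by case: pickle_inv => // kz; case: asboolP => // h; exact: h.
Qed.

Lemma compact_exhaustion_cover m : compact (exhaustion_cover m).
Proof.
apply: bigsetU_compact => i _; rewrite /inner_closed_cube; case: inner_index => [kz|].
  exact: compact_closed_box.
exact: compact0.
Qed.

(** A finite union of cubes of several levels is a union of cubes of the finest one. *)
Lemma exhaustion_saturated m : exists N, saturated (@dyadic R n) N (exhaustion m).
Proof.
rewrite /exhaustion; elim: m => [|m [N sN]]; first by exists 0%N; rewrite big_ord0.
rewrite big_ord_recr /= [inner_cube m]/inner_cube.
case Em: inner_index => [[k z]|]; last by exists N; rewrite setU0.
exists (maxn N k) => x y xy [Ix|Qx]; [left|right].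
  apply: sN Ix; apply: q_refine_le xy; [exact: dyadic_refine|exact: leq_maxl].
move: Qx => /= <-; apply/esym.
by apply: q_refine_le xy; [exact: dyadic_refine|exact: leq_maxr].
Qed.

Lemma measurable_exhaustion m : measurable (exhaustion m : set (lebesgue_space R n)).
Proof.
have [N sN] := exhaustion_saturated m.
exact: saturated_measurable measurable_dyadic _ _ sN.
Qed.

Lemma exhaustion_nondecreasing : nondecreasing_seq exhaustion.
Proof. by move=> a b ab; apply/subsetPset; exact: subset_bigsetU. Qed.

Lemma bigcup_exhaustion : open Omega -> \bigcup_m exhaustion m = Omega.
Proof.
move=> oO; apply/seteqP; split=> [x [m _ h]|x Ox].
  exact/exhaustion_cover_sub/exhaustion_sub_cover/h.
have /nbhs_ballP[e /= e0 xe] : nbhs x Omega by exact: open_nbhs_nbhs.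
have [k _ /(_ k (leqnn _)) /= ke] := side_cvg0 e0.
pose kz := (k, dyadic k x).
have sub : closed_cube kz `<=` Omega.
  move=> y hy; apply: xe; split=> // a b; rewrite (ord1 a).
  have := hy b; rewrite /= in_itv /= => /andP[y1 y2].
  have /dyadicP/(_ b)/andP[x1 x2] := erefl (dyadic k x).
  move: y1 y2 x1 x2; rewrite intrD mulrDl mul1r => y1 y2 x1 x2.
  by rewrite /ball /= ltr_norml; apply/andP; split; lra.
exists (pickle kz).+1 => //; rewrite /exhaustion big_ord_recr /=; right.
rewrite /inner_cube /inner_index pickleK_inv.
by case: asboolP.
Qed.

Lemma measurable_open : open Omega -> measurable (Omega : set (lebesgue_space R n)).
Proof.
move=> oO; rewrite -(bigcup_exhaustion oO).
by apply: bigcup_measurable => m _; exact: measurable_exhaustion.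
Qed.

End exhaustion.

Section local_estimate.
Context {R : realType} {n : nat}.
Local Notation leb := (lebesgue_rV R n).

Lemma measurable_closed_box l r : measurable (closed_box l r : set (lebesgue_space R n)).
Proof.
apply: borel_lebesgue_measurable.
have -> : closed_box l r = \bigcap_(j in [set: 'I_n]) [set x : 'rV[R]_n |
     `[l j, r j]%classic (x ord0 j)].
  by apply/seteqP; split=> x h j; [move=> _; exact: h|exact: h].
apply: fin_bigcap_measurable => // j _.
by have := @measurable_coor R n j measurableT `[l j, r j]%classic (measurable_itv _); rewrite setTI.
Qed.

Lemma locally_integrable_integrable (Omega A K : set 'rV[R]_n) (u : 'rV[R]_n -> R) :
  open Omega -> locally_integrable_rV Omega u ->
  measurable (A : set (lebesgue_space R n)) ->
  A `<=` K -> K `<=` Omega -> compact K -> leb.-integrable A (EFin \o u).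
Proof.
move=> oO [mu_ iu] mA AK KO cK; have mO := measurable_open oO.
have mK : measurable (K : set (lebesgue_space R n)).
  have cl : closed K by apply: compact_closed => //; exact: norm_hausdorff.
  by rewrite -(setCK K); apply: measurableC; apply: measurable_open; exact: closed_openC.
have mKu : measurable_fun (K : set (lebesgue_space R n)) u.
  exact: (measurable_funS mO KO mu_).
have mAu : measurable_fun (A : set (lebesgue_space R n)) u.
  exact: (measurable_funS mK AK mKu).
apply/integrableP; split; first exact/measurable_EFinP.
apply: le_lt_trans (iu _ KO cK).
have mKnu : measurable_fun (K : set (lebesgue_space R n)) (fun x => `|u x|%:E).
  by apply/measurable_EFinP; exact: (measurableT_comp (@normr_measurable R _) mKu).
by apply: (ge0_subset_integral _ mA mK mKnu _ AK) => x _; rewrite lee_fin normr_ge0.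
Qed.

Lemma integrable_mul_bounded (A : set 'rV[R]_n) (u h : 'rV[R]_n -> R) (D : R) :
  measurable (A : set (lebesgue_space R n)) ->
  leb.-integrable A (EFin \o u) ->
  measurable_fun [set: lebesgue_space R n] h -> (forall x, `|h x| <= D) ->
  leb.-integrable A (EFin \o (fun x => u x * h x)).
Proof.
move=> mA iu mh hD.
have mu_ : measurable_fun (A : set (lebesgue_space R n)) u.
  by apply/measurable_EFinP; exact: measurable_int iu.
apply: (le_integrable mA) (integrableZl mA D iu).
  apply/measurable_EFinP; apply: measurable_funM => //; exact: measurable_funTS.
move=> x _; rewrite /= lee_fin normrM [leRHS]normrM mulrC ler_wpM2r//.
by rewrite (le_trans (hD x))// ler_norm.
Qed.

Lemma osc_ge0 (E : set 'rV[R]_n) f x : E x -> (0 <= osc E f)%E.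
Proof.
move=> Ex; apply: ereal_sup_ubound; exists (x, x) => //=.
by rewrite subrr normr0.
Qed.

Lemma osc_ge (E : set 'rV[R]_n) f x y : E x -> E y -> (`|f x - f y|%:E <= osc E f)%E.
Proof. by move=> Ex Ey; apply: ereal_sup_ubound; exists (x, y). Qed.

Definition gradient_const : R := @kernel_bound R n * (2 * n.+1%:R).

Lemma gradient_const_gt0 : 0 < gradient_const.
Proof. by rewrite mulr_gt0 ?kernel_bound_gt0// mulr_gt0. Qed.

Lemma Rintegral_supp (A B : set 'rV[R]_n) (h : 'rV[R]_n -> R) : B `<=` A ->
  (forall x, ~ B x -> h x = 0) ->
  \int[leb]_(x in A) h x = \int[leb]_(x in B) h x.
Proof.
move=> BA hB; rewrite Rintegral_mkcond [RHS]Rintegral_mkcond.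
apply: eq_Rintegral => x _; rewrite !patchE.
case: ifPn => [_|]; case: ifPn => //; rewrite ?notin_setE ?inE.
- by move/hB.
- by move=> Bx; case; exact: BA.
Qed.

(** Integrate by parts, subtract from [f] its value at the centre of the ball (the
    derivative of the kernel has mean zero) and bound what remains by the
    oscillation.  An infinite oscillation makes the bound trivial. *)
Lemma gradient_average_le (Omega : set 'rV[R]_n) f g i k z :
  let B := eball (cube_center k z) (side k / 2) in
  open Omega -> is_weak_gradient Omega f g -> B `<=` Omega ->
  (`|\int[leb]_(x in Omega) (g x ord0 i * cube_kernel k z x)|%:E <=
   gradient_const%:E * (osc B f * ((side k / 2)^-1)%:E))%E.
Proof.
move=> B oO [lif /(_ i)[lig wg]] BO.
have s0 := side_gt0 (R := R) k; have w0 := core_width_gt0 (R := R) (n := n) k.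
have coreO : core k z `<=` Omega by apply: subset_trans BO; exact: core_sub_ball.
have -> : `|\int[leb]_(x in Omega) (g x ord0 i * cube_kernel k z x)| =
          `|\int[leb]_(x in Omega) (f x * grad_kernel k z i x)|.
  by rewrite /grad_kernel wg ?normrN//; exact: test_function_cube_kernel.
have Bc : B (cube_center k z).
  rewrite /B /eball /= subrr /enorm big1 ?sqrtr0 ?divr_gt0// => j _.
  by rewrite mxE expr0n.
have osc0 := osc_ge0 f Bc.
have [oy|] := eqVneq (osc B f) +oo%E.
  rewrite oy gt0_mulye ?lte_fin ?invr_gt0 ?divr_gt0//.
  by rewrite gt0_muley ?leey// lte_fin gradient_const_gt0.
rewrite -ltey -ge0_fin_numE// => oscfin.
set o := fine (osc B f); have o0 : 0 <= o by exact: fine_ge0.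
have oE : osc B f = o%:E by rewrite fineK.
have oscle x : core k z x -> `|f x - f (cube_center k z)| <= o.
  by move=> cx; rewrite -lee_fin -oE; apply: osc_ge => //; exact: core_sub_ball.
pose D := kernel_bound (R := R) (n := n) * (2 / @core_width R n k) / side k ^+ n.
have gD x : `|grad_kernel k z i x| <= D.
  by rewrite ler_pdivlMr ?exprn_gt0// mulrC; exact: grad_kernel_le.
have D0 : 0 <= D by apply: le_trans (gD 0).
have mcore : measurable (core k z : set (lebesgue_space R n)) by exact: measurable_closed_box.
have mg := measurable_grad_kernel (R := R) k z i.
have [igT gT] := integral_grad_kernel (R := R) k z i.
have ig : leb.-integrable (core k z) (EFin \o grad_kernel k z i).
  exact: (integrableS measurableT mcore (@subsetT _ _) igT).
have icf : leb.-integrable (core k z) (EFin \o f).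
  by apply: (locally_integrable_integrable oO lif mcore (@subset_refl _ _) coreO); exact: compact_closed_box.
have icfg := integrable_mul_bounded mcore icf mg gD.
have icore : leb.-integrable (core k z) (EFin \o (fun x => (f x - f (cube_center k z)) * grad_kernel k z i x)).
  have := integrableB mcore icfg (integrableZl mcore (f (cube_center k z)) ig).
  by apply: eq_integrable => // x _; rewrite /= mulrBl EFinB EFinM.
have lcore : (leb (core k z) <= (side k ^+ n)%:E)%E.
  rewrite -(lebesgue_dyadic k z); apply: le_measure; rewrite ?inE//.
    exact: measurable_dyadic.
  by move=> x /core_sub_ball/ball_sub_cube.
have lcorefin : (leb (core k z) < +oo)%E by rewrite (le_lt_trans lcore)// ltry.
have -> : \int[leb]_(x in Omega) (f x * grad_kernel k z i x) =
    \int[leb]_(x in core k z) ((f x - f (cube_center k z)) * grad_kernel k z i x).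
  rewrite (@Rintegral_supp _ (core k z))//; last first.
    by move=> x nx; rewrite grad_kernel_core// mulr0.
  under [RHS]eq_Rintegral do rewrite mulrBl.
  rewrite RintegralB//; last first.
    by have := integrableZl mcore (f (cube_center k z)) ig; apply: eq_integrable => // x _; rewrite /= EFinM.
  have gE : \int[leb]_x grad_kernel k z i x = \int[leb]_(x in core k z) grad_kernel k z i x.
    by apply: Rintegral_supp => // x nx; rewrite grad_kernel_core.
  by rewrite RintegralZl// -gE gT mulr0 subr0.
rewrite oE -!EFinM lee_fin.
apply: (le_trans (le_normr_Rintegral mcore icore)).
have -> : gradient_const * (o * (side k / 2)^-1) = (o * D) * side k ^+ n.
  rewrite /gradient_const /D /core_width; field.
  by rewrite ?nat1r ?natr1 ?pnatr_eq0 !gt_eqF// exprn_gt0.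
apply: (@le_trans _ _ (\int[leb]_(x in core k z) (o * D))).
  apply: le_Rintegral => //.
  - exact: integrable_norm.
  - apply/integrableP; split; first exact: measurable_cst.
    rewrite (eq_integral (cst (o * D)%:E)); last first.
      by move=> x _; rewrite /= ger0_norm // mulr_ge0.
    by rewrite integral_cst// lte_mul_pinfty// lee_fin mulr_ge0.
  move=> x cx; rewrite normrM; apply: ler_pM => //; exact: oscle.
rewrite Rintegral_cst//; apply: ler_wpM2l; first exact: mulr_ge0.
by rewrite -lee_fin fineK// ge0_fin_numE.
Qed.

End local_estimate.

(** * Truncation of powers *)

Section power_truncation.
Context {R : realType}.
Implicit Types (a b s t M p : R).

(** Convexity between [b] and [M + 1], of which [a] is a convex combination.  The
    end point [M + 1] keeps the denominator at least 1. *)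
Lemma powR_lipschitz p a b M : 1 <= p -> 0 <= b -> b <= a -> a <= M ->
  a `^ p <= b `^ p + (M + 1) `^ p * (a - b).
Proof.
move=> p1 b0 ba aM.
have d1 : 1 <= M + 1 - b by lra.
have d0 : 0 < M + 1 - b by lra.
pose t := (a - b) / (M + 1 - b).
have t0 : 0 <= t by apply: divr_ge0; lra.
have tab : t <= a - b.
  by rewrite ler_pdivrMr//; apply: ler_peMr => //; lra.
have t1 : t <= 1 by rewrite ler_pdivrMr// mul1r; lra.
have /= := @convex_powR R p p1 (Itv01 t0 t1) (M + 1) b.
rewrite !inE /= !in_itv /= !andbT => h.
have {}h := h (ltac:(lra)) b0.
have {}h : (t * (M + 1) + (1 - t) * b) `^ p <= t * (M + 1) `^ p + (1 - t) * b `^ p by [].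
have e : t * (M + 1) + (1 - t) * b = a.
  have -> : a = b + t * (M + 1 - b) by rewrite divfK ?gt_eqF//; lra.
  by ring.
rewrite e in h; apply: (le_trans h).
rewrite addrC lerD//.
  by rewrite ler_piMl ?powR_ge0// lerBlDl lerDr.
by rewrite mulrC ler_wpM2l// powR_ge0.
Qed.

(** A Lipschitz constant of (s, t) |-> min(s, M)^p min(t, M) on nonnegative pairs. *)
Definition truncation_const p M : R := (M + 1) `^ p * (M + 1).

(** Truncation on the right-hand side has been dropped, which only increases it;
    this lets the estimate for the averages be used without truncating them. *)
Lemma truncated_product_le p M s s' t t' : 1 <= p -> 0 <= M ->
  0 <= s -> 0 <= s' -> 0 <= t -> 0 <= t' ->
  (Num.min s M) `^ p * Num.min t M <=
  s' `^ p * t' + truncation_const p M * (`|s - s'| + `|t - t'|).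
Proof.
move=> p1 M0 s0 s'0 t0 t'0; have p0 : 0 <= p by lra.
set a := Num.min s M; set c := Num.min t M.
pose b := Num.min s' M; pose d := Num.min t' M.
have a0 : 0 <= a by rewrite le_min s0.
have b0 : 0 <= b by rewrite le_min s'0.
have c0 : 0 <= c by rewrite le_min t0.
have d0 : 0 <= d by rewrite le_min t'0.
have aM : a <= M by rewrite ge_min lexx orbT.
have dM : d <= M by rewrite ge_min lexx orbT.
have minlip u v : Num.min u M - Num.min v M <= `|u - v|.
  by rewrite /Num.min; case: ltP => h1; case: ltP => h2;
    have := ler_norm (u - v); have := normr_ge0 (u - v); lra.
set K := (M + 1) `^ p.
have K0 : 0 <= K by exact: powR_ge0.
have aK : a `^ p <= K by apply: ge0_ler_powR => //; rewrite ?nnegrE; lra.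
have h1 : a `^ p - b `^ p <= K * `|s - s'|.
  have [ba|ab] := leP b a.
    have := powR_lipschitz p1 b0 ba aM; rewrite -/K.
    have : K * (a - b) <= K * `|s - s'| by apply: ler_wpM2l => //; exact: minlip.
    lra.
  have : a `^ p <= b `^ p by apply: ge0_ler_powR => //; rewrite ?nnegrE//; exact: ltW.
  have : 0 <= K * `|s - s'| by rewrite mulr_ge0.
  lra.
have h2 : b `^ p * d <= s' `^ p * t'.
  apply: ler_pM => //; first exact: powR_ge0.
    by apply: ge0_ler_powR => //; rewrite ?nnegrE// ge_min lexx.
  by rewrite ge_min lexx.
have -> : a `^ p * c = b `^ p * d + (a `^ p * (c - d) + (a `^ p - b `^ p) * d) by ring.
apply: lerD => //.
rewrite /truncation_const -/K [leRHS]mulrDr [leLHS]addrC; apply: lerD.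
  apply: (@le_trans _ _ (K * `|s - s'| * d)).
    exact: ler_wpM2r.
  rewrite -mulrA -[leRHS]mulrA [(M + 1) * _]mulrC; apply: ler_wpM2l => //.
  by apply: ler_wpM2l => //; lra.
apply: (@le_trans _ _ (K * `|t - t'|)).
  apply: (@le_trans _ _ (a `^ p * `|t - t'|)).
    by apply: ler_wpM2l; [exact: powR_ge0|exact: minlip].
  exact: ler_wpM2r.
by apply: ler_wpM2r => //; rewrite ler_peMr//; lra.
Qed.

Lemma truncated_integral_le d (T : measurableType d) (mu : {measure set T -> \bar R})
    (U : set T) (p M : R) (u v G W : T -> R) : 1 <= p -> 0 <= M ->
  measurable U -> measurable_fun setT u -> measurable_fun setT v ->
  measurable_fun setT G -> measurable_fun setT W ->
  (forall x, 0 <= v x) -> (forall x, 0 <= W x) ->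
  (\int[mu]_(x in U) ((Num.min `|u x| M) `^ p * Num.min (v x) M)%:E <=
   \int[mu]_(x in U) (`|G x| `^ p * W x)%:E + (truncation_const p M)%:E *
     (\int[mu]_x `|u x - G x|%:E + \int[mu]_x `|v x - W x|%:E))%E.
Proof.
move=> p1 M0 mU mu_ mv mG mW v0 W0.
set L := truncation_const p M.
have L0 : 0 <= L by rewrite mulr_ge0 ?powR_ge0//; lra.
have mpow (h : T -> R) : measurable_fun setT h -> measurable_fun setT (fun x => h x `^ p).
  by move=> mh; apply: (measurableT_comp (measurable_powR p)).
have m1 : measurable_fun setT (fun x => `|G x| `^ p * W x).
  by apply: measurable_funM => //; apply: mpow; exact: measurableT_comp.
have m2 : measurable_fun setT (fun x => `|u x - G x|).
  by apply: measurableT_comp => //; exact: measurable_funB.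
have m3 : measurable_fun setT (fun x => `|v x - W x|).
  by apply: measurableT_comp => //; exact: measurable_funB.
have m4 : measurable_fun setT (fun x => L * (`|u x - G x| + `|v x - W x|)).
  by apply: measurable_funM => //; exact: measurable_funD.
apply: (@le_trans _ _ (\int[mu]_(x in U) ((`|G x| `^ p * W x)%:E +
   (L * (`|u x - G x| + `|v x - W x|))%:E))%E).
  apply: ge0_le_integral => //.
  - by move=> x _; rewrite lee_fin mulr_ge0 ?powR_ge0// le_min v0.
  - apply/measurable_EFinP; apply: measurable_funTS; apply: measurable_funM.
      by apply: mpow; apply: measurable_minr => //; exact: measurableT_comp.
    exact: measurable_minr.
  - apply: emeasurable_funD; apply/measurable_EFinP; exact: measurable_funTS.
  move=> x _; rewrite -EFinD lee_fin.
  apply: (le_trans (@truncated_product_le p M `|u x| `|G x| (v x) (W x) p1 M0 _ _ _ _)) => //.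
  rewrite lerD2l; apply: ler_wpM2l => //; rewrite lerD2r.
  exact: ler_dist_dist.
rewrite ge0_integralD//; last 4 first.
- by move=> x _; rewrite lee_fin mulr_ge0 ?powR_ge0.
- by apply/measurable_EFinP; exact: measurable_funTS.
- by move=> x _; rewrite lee_fin mulr_ge0// addr_ge0.
- by apply/measurable_EFinP; exact: measurable_funTS.
apply: leeD => //.
rewrite -ge0_integralD//; [|exact/measurable_EFinP..].
rewrite -ge0_integralZl//; last 2 first.
- by apply: emeasurable_funD; exact/measurable_EFinP.
- by move=> x _; rewrite adde_ge0.
rewrite [leLHS](_ : _ = \int[mu]_(x in U) (L%:E * (`|u x - G x|%:E + `|v x - W x|%:E)))%E; last first.
  by apply: eq_integral => x _; rewrite -EFinD -EFinM.
apply: ge0_subset_integral => //.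
- by apply: measurable_funeM; apply: emeasurable_funD; exact/measurable_EFinP.
- by move=> x _; rewrite mule_ge0// lee_fin.
Qed.

(** Monotone convergence, with the height of truncation and the domain increasing
    together; at each point the integrand is eventually constant. *)
Lemma exhausted_integral_le d (T : measurableType d) (mu : {measure set T -> \bar R})
    (D : set T) (U : nat -> set T) (p : R) (a b : T -> R) (B : \bar R) : 0 <= p ->
  measurable D -> (forall m, measurable (U m)) -> nondecreasing_seq U ->
  \bigcup_m U m = D -> measurable_fun D a -> measurable_fun D b ->
  (forall x, 0 <= a x) -> (forall x, 0 <= b x) ->
  (forall m, \int[mu]_(x in U m)
     ((Num.min (a x) m%:R) `^ p * Num.min (b x) m%:R)%:E <= B)%E ->
  (\int[mu]_(x in D) (a x `^ p * b x)%:E <= B)%E.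
Proof.
move=> p0 mD mU ndU UD ma mb a0 b0 hB.
pose h m x := (((Num.min (a x) m%:R) `^ p * Num.min (b x) m%:R)%:E : \bar R).
pose hU m := h m \_ (U m).
have h0 m x : (0 <= h m x)%E.
  by rewrite lee_fin mulr_ge0 ?powR_ge0// le_min b0 ler0n.
have hU0 m x : (0 <= hU m x)%E by rewrite /hU patchE; case: ifP.
have mh m : measurable_fun D (h m).
  apply/measurable_EFinP; apply: measurable_funM; last exact: measurable_minr.
  by apply: (measurableT_comp (measurable_powR p)); exact: measurable_minr.
have mhU m : measurable_fun D (hU m).
  apply/measurable_restrict => //.
  by apply: measurable_funS (mh m) => //; exact: subIsetl.
have nd_h x : {homo h^~ x : i j / (i <= j)%N >-> (i <= j)%E}.
  move=> i j ij; rewrite lee_fin.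
  have ijR : i%:R <= j%:R :> R by rewrite ler_nat.
  have minle t : Num.min t i%:R <= Num.min t j%:R.
    by rewrite le_min ge_min lexx /= ge_min ijR orbT.
  apply: ler_pM.
  - exact: powR_ge0.
  - by rewrite le_min b0 ler0n.
  - by apply: ge0_ler_powR => //; rewrite ?nnegrE ?le_min ?a0 ?ler0n.
  - exact: minle.
have nd_hU x : {homo hU^~ x : i j / (i <= j)%N >-> (i <= j)%E}.
  move=> i j ij; rewrite /hU !patchE.
  case: ifPn => [|_]; last by case: ifP.
  rewrite inE => Ui; rewrite mem_set; first exact: nd_h.
  by have /subsetPset := ndU _ _ ij; apply.
rewrite [leLHS](_ : _ = limn (fun m => \int[mu]_(x in D) hU m x))%E; last first.
  rewrite -monotone_convergence//.
  apply: eq_integral => x; rewrite inE => Dx; apply/esym/cvg_lim => //.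
  have [m0 _ Um0] : (\bigcup_m U m) x by rewrite UD.
  apply: cvg_near_cst.
  exists (maxn m0 (maxn (Num.bound (a x)) (Num.bound (b x)))) => // m /=.
  rewrite !geq_max => /and3P[m0m am bm].
  have Um : U m x by have /subsetPset := ndU _ _ m0m; apply.
  rewrite /hU patchE mem_set// /h !min_l//.
  - by rewrite (le_trans (ltW (archi_boundP _)))// ler_nat.
  - by rewrite (le_trans (ltW (archi_boundP _)))// ler_nat.
apply: lime_le.
  apply: ereal_nondecreasing_is_cvgn => i j ij.
  by apply: ge0_le_integral => // x _; exact: nd_hU.
apply: nearW => m; rewrite /hU -integral_mkcondr setIidr//.
by rewrite -UD => x Ux; exists m.
Qed.

End power_truncation.

(** * One dyadic level *)

Lemma esum_scale_le {R : realType} (T : choiceType) (D : set T) (c : \bar R) (a : T -> \bar R) :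
  (0 <= c)%E -> (forall i, (0 <= a i)%E) ->
  (\esum_(i in D) (c * a i) <= c * \esum_(i in D) a i)%E.
Proof.
move=> c0 a0; apply: ge_ereal_sup => _ [X XD <-].
rewrite -ge0_mule_fsumr//; apply: lee_wpmul2l => //.
by apply: ereal_sup_ubound; exists X.
Qed.

Section level_sum.
Context {R : realType} {n : nat}.
Local Notation leb := (lebesgue_rV R n).
Variables (Omega : set 'rV[R]_n) (p : R) (w f : 'rV[R]_n -> R).
Hypotheses (p1 : 1 <= p) (w0 : forall x, 0 <= w x).

Definition cube_ball k (z : 'rV[int]_n) : set 'rV[R]_n :=
  eball (cube_center k z) (side k / 2).

Definition sup_variation : \bar R :=
  ereal_sup [set variation_sum w p f D | D in disjoint_balls Omega].

Definition ball_term (b : 'rV[R]_n * R) : \bar R :=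
  ((osc (eball b.1 b.2) f * (b.2^-1)%:E) `^ p * weight_of w (eball b.1 b.2))%E.

Lemma weight_of_ge0 E : (0 <= weight_of w E)%E.
Proof. by apply: integral_ge0 => x _; rewrite lee_fin. Qed.

Lemma ball_term_ge0 b : (0 <= ball_term b)%E.
Proof. by rewrite mule_ge0 ?poweR_ge0 ?weight_of_ge0. Qed.

Lemma cube_ball_center k z : cube_ball k z (cube_center k z).
Proof.
rewrite /cube_ball /eball /= subrr /enorm big1 ?sqrtr0 ?divr_gt0 ?side_gt0// => j _.
by rewrite mxE expr0n.
Qed.

(** The balls lie in different cubes, hence are disjoint, so they form one of the
    families over which the variation is a supremum. *)
Lemma cube_balls_esum_le k (Z : set 'rV[int]_n) :
  (forall z, Z z -> cube_ball k z `<=` Omega) ->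
  (\esum_(z in Z) ball_term (cube_center k z, (side k / 2)%R) <= sup_variation)%E.
Proof.
move=> ZO; pose e (z : 'rV[int]_n) : 'rV[R]_n * R := (cube_center k z, side k / 2).
have cubeE z x : cube_ball k z x -> dyadic k x = z by move=> /ball_sub_cube.
have einj : injective e.
  move=> z z' [zz']; rewrite -(cubeE z _ (cube_ball_center k z)).
  by rewrite zz'; apply: cubeE; exact: cube_ball_center.
rewrite -(@esum_image _ _ _ Z e ball_term); last by move=> x y _ _ /einj.
apply: ereal_sup_ubound; exists (e @` Z) => //; split.
- by apply: (@sub_countable _ _ _ Z); [exact: card_image_le|exact: countableP].
- by move=> _ [z Zz <-]; split; [rewrite /= divr_gt0 ?side_gt0|exact: ZO].
- move=> _ _ [z Zz <-] [z' Zz' <-] [x [/= xz xz']].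
  by rewrite -(cubeE _ _ xz) -(cubeE _ _ xz').
Qed.

Definition level_const : R := (gradient_const (R := R) (n := n)) `^ p * kernel_bound (R := R) (n := n).

(** The integrand is constant on cubes, so the integral is a sum over the cubes
    contained in [U], and it is compared term by term with the sum over their
    inscribed balls. *)
Lemma level_integral_le k (U : set 'rV[R]_n) (G W : 'rV[R]_n -> R) :
  saturated (@dyadic R n) k U -> U `<=` Omega ->
  fibrewise_cst (@dyadic R n) k G -> fibrewise_cst (@dyadic R n) k W ->
  (forall x, 0 <= W x) ->
  (forall x, U x -> (`|G x|%:E <= (gradient_const (R := R) (n := n))%:E *
     (osc (cube_ball k (dyadic k x)) f * ((side k / 2)^-1)%:E))%E) ->
  (forall x, U x -> ((side k ^+ n * W x)%:E <= (kernel_bound (R := R) (n := n))%:E *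
     weight_of w (cube_ball k (dyadic k x)))%E) ->
  (\int[leb]_(x in U) (`|G x| `^ p * W x)%:E <= level_const%:E * sup_variation)%E.
Proof.
move=> sU UO cG cW W0 hG hW.
have p0 : 0 <= p by apply: le_trans p1.
pose F x := `|G x| `^ p * W x.
have cF : fibrewise_cst (@dyadic R n) k F by move=> x y xy; rewrite /F (cG x y) ?(cW x y).
have mF : measurable_fun [set: lebesgue_space R n] F.
  exact: fibrewise_cst_measurable measurable_dyadic _ _ cF.
have F0 x : 0 <= F x by rewrite mulr_ge0 ?powR_ge0.
have mU : measurable (U : set (lebesgue_space R n)).
  exact: saturated_measurable measurable_dyadic _ _ sU.
rewrite integral_mkcond (@ge0_integral_fibres _ _ _ leb _ _ measurable_dyadic k); last 2 first.
- by apply/(measurable_restrictT _ mU).1/measurable_EFinP; exact: measurable_funTS.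
- by move=> x; rewrite patchE; case: ifP => // _; rewrite lee_fin F0.
pose Z := [set z | dyadic k @^-1` [set z] `<=` U].
have level0 : (0 <= level_const%:E :> \bar R)%E.
  by rewrite lee_fin mulr_ge0 ?powR_ge0// ltW// kernel_bound_gt0.
have ZO z : Z z -> cube_ball k z `<=` Omega.
  by move=> Zz x /ball_sub_cube/Zz/UO.
apply: (@le_trans _ _ (\esum_(z in Z) (level_const%:E * ball_term (cube_center k z, (side k / 2)%R)))%E); last first.
  apply: le_trans (esum_scale_le _ level0 (fun z => ball_term_ge0 _)) _.
  by apply: lee_wpmul2l => //; exact: cube_balls_esum_le.
rewrite [leRHS]esum_mkcond. apply: (@le_esum R 'rV[int]_n setT) => z _ /=.
have [x xz] : exists x : 'rV[R]_n, dyadic k x = z.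
  by exists (cube_center k z); exact: (ball_sub_cube (cube_ball_center k z)).
case: ifPn => [|nZ]; last first.
  rewrite integral0_eq// => y yz; rewrite patchE; case: ifPn => //; rewrite inE => Uy.
  exfalso; move: nZ; rewrite notin_setE; apply => y' y'z.
  by apply: sU Uy; rewrite yz y'z.
rewrite inE => Zz; have Ux : U x by exact: Zz.
rewrite (eq_integral (cst (F x)%:E)); last first.
  move=> y; rewrite inE => yz; rewrite patchE mem_set; last exact: Zz.
  by congr EFin; apply: cF; rewrite yz xz.
rewrite integral_cst; last exact: measurable_dyadic.
rewrite lebesgue_dyadic -EFinM -mulrA [W x * _]mulrC EFinM.
have -> : (level_const%:E * ball_term (cube_center k z, (side k / 2)%R) =
   (((gradient_const (R := R) (n := n))%:E * (osc (cube_ball k z) f * ((side k / 2)^-1)%:E)) `^ p) *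
   ((kernel_bound (R := R) (n := n))%:E * weight_of w (cube_ball k z)))%E.
  rewrite poweRM; last 2 first.
  - by rewrite lee_fin ltW// gradient_const_gt0.
  - rewrite mule_ge0 ?lee_fin ?invr_ge0 ?divr_ge0 ?(ltW (side_gt0 _))//.
    exact: osc_ge0 (cube_ball_center k z).
  by rewrite poweR_EFin /level_const EFinM /ball_term /= muleACA.
apply: lee_pmul.
- by rewrite lee_fin powR_ge0.
- by rewrite lee_fin mulr_ge0// exprn_ge0// ltW// side_gt0.
- rewrite -poweR_EFin; apply: gt0_ler_poweR => //.
  + by rewrite in_itv /= leey andbT lee_fin.
  + by rewrite in_itv /= leey andbT -xz; apply: le_trans (hG x Ux); rewrite lee_fin.
  + rewrite -xz; exact: hG.
- by rewrite -xz; exact: hW.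
Qed.

End level_sum.

(** * Passage to the limit *)

Section coordinate_bound.
Context {R : realType} {n : nat}.
Local Notation leb := (lebesgue_rV R n).

Lemma measurable_fun_enorm d (T : measurableType d) (D : set T) (h : T -> 'rV[R]_n) :
  (forall j, measurable_fun D (fun t => h t ord0 j)) ->
  measurable_fun D (fun t => enorm (h t)).
Proof.
move=> mh; apply: (measurableT_comp (f := @Num.sqrt R)).
  by apply: continuous_measurable_fun; exact: sqrt_continuous.
apply: measurable_sum => j.
under eq_fun do rewrite expr2.
exact: measurable_funM.
Qed.

Lemma measurable_eball c r : measurable (@eball R n c r : set (lebesgue_space R n)).
Proof.
have mf : measurable_fun [set: 'rV[R]_n] (fun x : 'rV[R]_n => enorm (x - c)).
  apply: measurable_fun_enorm => j.
  rewrite (_ : (fun _ => _) = (fun x : 'rV[R]_n => x ord0 j + (- c ord0 j))).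
    by apply: measurable_funD => //; exact: measurable_coor.
  by apply/funext => x; rewrite !mxE.
apply: borel_lebesgue_measurable.
have := mf measurableT `]-oo, r[%classic (measurable_itv _); rewrite setTI.
by congr measurable; apply/seteqP; split => x; rewrite /eball /= in_itv.
Qed.

Lemma side_expn_gt0 k : 0 < side k ^+ n :> R.
Proof. by rewrite exprn_gt0// side_gt0. Qed.

Lemma integrable_mul_cube_kernel k z (u : 'rV[R]_n -> R) :
  leb.-integrable setT (EFin \o u) ->
  leb.-integrable setT (EFin \o (fun y => u y * cube_kernel k z y)).
Proof.
exact: (integrable_mul_kernel side_expn_gt0 (ltW kernel_bound_gt0) (@measurable_cube_kernel R n)
  (@cube_kernel_ge0 R n) (@cube_kernel_le R n)).
Qed.

Lemma cube_average_cvg_L1 (u : 'rV[R]_n -> R) (e : R) :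
  leb.-integrable setT (EFin \o u) -> 0 < e -> \forall k \near \oo,
  (\int[leb]_x `|u x - average leb (@dyadic R n) (@cube_kernel R n) k u x|%:E <= e%:E)%E.
Proof.
move=> iu e0; exact: (@average_cvg_L1 R _ (lebesgue_space R n) leb _ (@dyadic R n) dyadic_refine measurable_dyadic _ _ _ side_expn_gt0
  (ltW kernel_bound_gt0) (@lebesgue_dyadic R n) (@measurable_cube_kernel R n)
  (@cube_kernel_ge0 R n) (@cube_kernel_supp R n) (@cube_kernel_le R n)
  (@integral_cube_kernel R n) _ _ (dyadic_integrable_L1_approximable iu) e0).
Qed.

Variables (Omega : set 'rV[R]_n) (p : R) (w f : 'rV[R]_n -> R) (g : 'rV[R]_n -> 'rV[R]_n).
Hypotheses (oO : open Omega) (p1 : 1 <= p) (hw : is_weight w).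
Hypothesis hg : is_weak_gradient Omega f g.
Variable i : 'I_n.

Let w0 x : 0 <= w x. Proof. by case: hw. Qed.
Let p0 : 0 <= p. Proof. exact: le_trans p1. Qed.
Let mO : measurable (Omega : set (lebesgue_space R n)). Proof. exact: measurable_open. Qed.
Let lig : locally_integrable_rV Omega (fun x => g x ord0 i).
Proof. by case: hg => _ /(_ i)[]. Qed.
Let lw : locally_integrable_rV [set: 'rV[R]_n] w. Proof. by case: hw. Qed.

Local Notation avg := (average leb (@dyadic R n) (@cube_kernel R n)).
Local Notation kb := (@kernel_bound R n).

Section window.
Variables (U K : set 'rV[R]_n) (N : nat).
Hypotheses (sU : saturated (@dyadic R n) N U) (UK : U `<=` K) (KO : K `<=` Omega).
Hypothesis cK : compact K.

Let mU : measurable (U : set (lebesgue_space R n)).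
Proof. exact: saturated_measurable measurable_dyadic _ _ sU. Qed.

Let u : 'rV[R]_n -> R := (fun x => g x ord0 i) \_ U.
Let v : 'rV[R]_n -> R := w \_ U.

Let iu : leb.-integrable setT (EFin \o u).
Proof.
rewrite /u -restrict_EFin; apply/(integrable_mkcond _ mU).1.
exact: (locally_integrable_integrable oO lig mU UK KO cK).
Qed.

Let iv : leb.-integrable setT (EFin \o v).
Proof.
rewrite /v -restrict_EFin; apply/(integrable_mkcond _ mU).1.
exact: (locally_integrable_integrable openT lw mU UK (@subsetT _ _) cK).
Qed.

Let v0 x : 0 <= v x.
Proof. by rewrite /v patchE; case: ifP. Qed.

(** On a cube inside [U] the average of the component restricted to [U] is the
    pairing of the weak gradient with the kernel. *)
Lemma average_gradient_le k x : (N <= k)%N -> U x ->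
  (`|avg k u x|%:E <= (@gradient_const R n)%:E *
     (osc (cube_ball k (dyadic k x)) f * ((side k / 2)^-1)%:E))%E.
Proof.
move=> Nk Ux; have sk := saturated_le dyadic_refine Nk sU.
have QU : dyadic k @^-1` [set dyadic k x] `<=` U by move=> y /= yx; apply: sk Ux.
have -> : avg k u x = \int[leb]_(y in Omega) (g y ord0 i * cube_kernel k (dyadic k x) y).
  rewrite /average [RHS]Rintegral_mkcond; apply: eq_Rintegral => y _.
  rewrite /u !patchE; have [Uy|nUy] := pselect (U y).
    by rewrite !mem_set//; exact/KO/UK.
  rewrite memNset// mul0r; case: ifP => // _; rewrite cube_kernel_supp ?mulr0//.
  by apply/eqP => /QU.
apply: gradient_average_le => //.
by move=> y /ball_sub_cube/QU/UK/KO.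
Qed.

Lemma average_weight_le k x :
  ((side k ^+ n * avg k v x)%:E <= kb%:E * weight_of w (cube_ball k (dyadic k x)))%E.
Proof.
have s0 : 0 <= side k ^+ n :> R by rewrite exprn_ge0// ltW// side_gt0.
have mw : measurable_fun [set: lebesgue_space R n] w by case: lw.
have mv : measurable_fun [set: lebesgue_space R n] v.
  by apply/measurable_EFinP; exact: measurable_int iv.
have mk := @measurable_cube_kernel R n k (dyadic k x).
have ivk := integrable_mul_cube_kernel k (dyadic k x) iv.
have mB : measurable (cube_ball k (dyadic k x) : set (lebesgue_space R n)).
  exact: measurable_eball.
apply: (kernel_weight_le mB mv mw mk ivk s0 (ltW kernel_bound_gt0)).
- by move=> y; rewrite v0 /= /v patchE; case: ifP.
- exact: cube_kernel_ge0.
- exact: cube_kernel_le.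
- by move=> y nB; apply: cube_kernel_core => /core_sub_ball.
Qed.

(** At each fine level the truncated integrand is controlled by the averaged one, up
    to a multiple of two L^1 distances that tend to zero. *)
Lemma window_bound (M : R) : 0 <= M ->
  (\int[leb]_(x in U) ((Num.min `|g x ord0 i| M) `^ p * Num.min (w x) M)%:E <=
   (@level_const R n p)%:E * sup_variation Omega p w f)%E.
Proof.
move=> M0; apply/lee_addgt0Pr => e e0.
pose L := truncation_const p M.
have L0 : 0 <= L by rewrite mulr_ge0 ?powR_ge0//; lra.
(* Two errors of size [e'], multiplied by [L], must stay below [e]. *)
pose e' := e / (2 * (L + 1)).
have e'0 : 0 < e' by rewrite divr_gt0// mulr_gt0//; lra.
have [k1 _ hk1] := cube_average_cvg_L1 iu e'0.
have [k2 _ hk2] := cube_average_cvg_L1 iv e'0.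
pose k := maxn N (maxn k1 k2).
have Nk : (N <= k)%N by exact: leq_maxl.
have {}hk1 := hk1 k (leq_trans (leq_maxl _ _) (leq_maxr _ _)).
have {}hk2 := hk2 k (leq_trans (leq_maxr _ _) (leq_maxr _ _)).
have cG := @average_fibrewise_cst R _ _ leb _ (@dyadic R n) (@cube_kernel R n) k u.
have cW := @average_fibrewise_cst R _ _ leb _ (@dyadic R n) (@cube_kernel R n) k v.
have mG : measurable_fun [set: lebesgue_space R n] (avg k u).
  exact: fibrewise_cst_measurable measurable_dyadic _ _ cG.
have mW : measurable_fun [set: lebesgue_space R n] (avg k v).
  exact: fibrewise_cst_measurable measurable_dyadic _ _ cW.
have mu_ : measurable_fun [set: lebesgue_space R n] u.
  by apply/measurable_EFinP; exact: measurable_int iu.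
have mv : measurable_fun [set: lebesgue_space R n] v.
  by apply/measurable_EFinP; exact: measurable_int iv.
have W0 x : 0 <= avg k v x.
  by apply: Rintegral_ge0 => y _; rewrite mulr_ge0// cube_kernel_ge0.
have main := level_integral_le p1 w0 (saturated_le dyadic_refine Nk sU) (subset_trans UK KO)
  cG cW W0 (fun x => @average_gradient_le k x Nk) (fun x _ => average_weight_le k x).
rewrite (eq_integral (fun x : lebesgue_space R n => ((Num.min `|u x| M) `^ p * Num.min (v x) M)%:E)); last first.
  by move=> x xU; rewrite /u /v !patchE xU.
apply: (le_trans (truncated_integral_le leb p1 M0 mU mu_ mv mG mW v0 W0)).
apply: leeD; first exact: main.
apply: (@le_trans _ _ (L%:E * (e'%:E + e'%:E))%E).
  by apply: lee_wpmul2l; [rewrite lee_fin|exact: (leeD hk1 hk2)].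
rewrite -EFinD -EFinM lee_fin.
have -> : L * (e' + e') = e * (L / (L + 1)).
  by rewrite /e'; field; lra.
rewrite ger_pMr// ler_pdivrMr; lra.
Qed.

End window.

Lemma coordinate_bound :
  (\int[leb]_(x in Omega) (`|g x ord0 i| `^ p * w x)%:E <=
   (@level_const R n p)%:E * sup_variation Omega p w f)%E.
Proof.
have mw : measurable_fun [set: lebesgue_space R n] w by case: lw.
have mgi : measurable_fun (Omega : set (lebesgue_space R n)) (fun x => g x ord0 i) by case: lig.
have ma : measurable_fun (Omega : set (lebesgue_space R n)) (fun x => `|g x ord0 i|).
  exact: (measurableT_comp (@normr_measurable R _) mgi).
apply: (exhausted_integral_le p0 mO (@measurable_exhaustion R n Omega)
  (exhaustion_nondecreasing Omega) (bigcup_exhaustion oO) ma (measurable_funTS mw)) => //.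
move=> m; have [N sN] := exhaustion_saturated Omega m.
exact: (window_bound sN (@exhaustion_sub_cover _ _ _ m) (@exhaustion_cover_sub _ _ _ m)
  (compact_exhaustion_cover (m:=m)) (ler0n _ m)).
Qed.

End coordinate_bound.

(** * All coordinates together *)

(** Compare with the largest coordinate. *)
Lemma enorm_powR_le {R : realType} n (p : R) (x : 'rV[R]_n) : 1 <= p ->
  enorm x `^ p <= n%:R `^ p * \sum_i `|x ord0 i| `^ p.
Proof.
move=> p1; have p0 : 0 <= p by apply: le_trans p1.
case: n x => [|n] x.
  by rewrite /enorm big_ord0 sqrtr0 powR0 ?mulr_ge0 ?powR_ge0 ?big_ord0// gt_eqF//; lra.
have [i _ imax] := @arg_maxP _ R 'I_n.+1 ord0 xpredT (fun j => `|x ord0 j|) isT.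
have le1 : enorm x <= n.+1%:R * `|x ord0 i|.
  have nx : 0 <= n.+1%:R * `|x ord0 i| by rewrite mulr_ge0.
  rewrite -[leRHS]ger0_norm// -sqrtr_sqr ler_sqrt ?sqr_ge0//.
  apply: (@le_trans _ _ (\sum_(j < n.+1) `|x ord0 i| ^+ 2)).
    apply: ler_sum => j _; rewrite -[leLHS]real_normK ?num_real//.
    by rewrite ler_pXn2r ?nnegrE//; exact: imax.
  rewrite sumr_const card_ord -[_ *+ n.+1]mulr_natl exprMn ler_wpM2r ?sqr_ge0//.
  by rewrite -natrX ler_nat expnS expn1 leq_pmulr.
apply: (@le_trans _ _ ((n.+1%:R * `|x ord0 i|) `^ p)).
  by apply: ge0_ler_powR => //; rewrite nnegrE ?sqrtr_ge0 ?mulr_ge0.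
rewrite powRM//; apply: ler_wpM2l; first exact: powR_ge0.
by rewrite (bigD1 i)//= lerDl sumr_ge0// => j _; exact: powR_ge0.
Qed.

Lemma integral_enorm_le {R : realType} n d (T : measurableType d)
    (mu : {measure set T -> \bar R}) (D : set T) (p : R) (g : T -> 'rV[R]_n)
    (w : T -> R) (B : \bar R) : 1 <= p ->
  measurable D -> (forall i, measurable_fun D (fun x => g x ord0 i)) ->
  measurable_fun D w -> (forall x, 0 <= w x) -> (0 <= B)%E ->
  (forall i, \int[mu]_(x in D) (`|g x ord0 i| `^ p * w x)%:E <= B)%E ->
  (\int[mu]_(x in D) (enorm (g x) `^ p * w x)%:E <= (n%:R `^ p * n%:R)%:E * B)%E.
Proof.
move=> p1 mD mg mw w0 B0 hB.
have mpow (h : T -> R) : measurable_fun D h -> measurable_fun D (fun x => h x `^ p).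
  by move=> mh; apply: (measurableT_comp (measurable_powR p)).
have mi i : measurable_fun D (fun x => (`|g x ord0 i| `^ p * w x)%:E).
  apply/measurable_EFinP; apply: measurable_funM => //.
  by apply: mpow; exact: measurableT_comp.
have i0 i x : (0 <= (`|g x ord0 i| `^ p * w x)%:E)%E.
  by rewrite lee_fin mulr_ge0 ?powR_ge0.
have ms : measurable_fun D (fun x => \sum_(i < n) (`|g x ord0 i| `^ p * w x)%:E)%E.
  exact: emeasurable_sum.
apply: (@le_trans _ _ (\int[mu]_(x in D)
   ((n%:R `^ p)%:E * \sum_(i < n) (`|g x ord0 i| `^ p * w x)%:E))%E).
  apply: ge0_le_integral => //.
  - by move=> x _; rewrite lee_fin mulr_ge0 ?powR_ge0.
  - apply/measurable_EFinP; apply: measurable_funM => //.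
    by apply: mpow; exact: measurable_fun_enorm.
  - exact: measurable_funeM.
  - move=> x _; rewrite sumEFin -EFinM lee_fin -mulr_suml mulrA.
    by apply: ler_wpM2r => //; exact: enorm_powR_le.
rewrite ge0_integralZl//; last by move=> x _; exact: sume_ge0.
rewrite ge0_integral_sum// EFinM -muleA.
apply: lee_wpmul2l; first by rewrite lee_fin powR_ge0.
apply: (@le_trans _ _ (\sum_(i < n) (1 * B))%E).
  by apply: lee_sum => i _; rewrite mul1e.
rewrite -ge0_sume_distrl//; apply: lee_wpmul2r => //.
by rewrite sumEFin lee_fin sumr_const card_ord.
Qed.

Theorem corollary1p3 (R : realType) (n : nat) (Omega : set 'rV[R]_n)
    (p : R) (w : 'rV[R]_n -> R) :
  open Omega -> 1 <= p -> is_weight w ->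
  exists2 C : R, 0 < C &
    forall f : 'rV[R]_n -> R, RBV Omega w p f ->
    forall gradf : 'rV[R]_n -> 'rV[R]_n, is_weak_gradient Omega f gradf ->
      (weighted_Lnorm Omega w p gradf <= C%:E * riesz_variation Omega w p f)%E.
Proof.
move=> oO p1 hw; have p0 : 0 <= p by apply: le_trans p1.
have pV0 : 0 <= p^-1 by rewrite invr_ge0.
have level0 : 0 <= @level_const R n p by rewrite mulr_ge0 ?powR_ge0// ltW// kernel_bound_gt0.
(* The summand 1 keeps the constant positive when [n = 0]. *)
pose C0 := n%:R `^ p * (n%:R * @level_const R n p) + 1.
have C00 : 0 < C0 by rewrite ltr_wpDl// mulr_ge0 ?powR_ge0// mulr_ge0.
exists (C0 `^ p^-1); first exact: powR_gt0.
move=> f _ g hg; have w0 x : 0 <= w x by case: hw.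
set S := sup_variation Omega p w f.
have S0 : (0 <= S)%E.
  apply: ereal_sup_ubound; exists set0; last by rewrite /variation_sum esum_set0.
  by split=> // [|b c []]; exact: countable0.
rewrite /weighted_Lnorm /riesz_variation -poweR_EFin -poweRM//; last by rewrite lee_fin ltW.
have mO : measurable (Omega : set (lebesgue_space R n)) by exact: measurable_open.
have mw : measurable_fun [set: lebesgue_space R n] w by case: hw => _ [].
have mg i : measurable_fun (Omega : set (lebesgue_space R n)) (fun x => g x ord0 i).
  by case: hg => _ /(_ i)[[]].
have level_S0 : (0 <= (@level_const R n p)%:E * S)%E by exact: mule_ge0.
have main := integral_enorm_le p1 mO mg (measurable_funTS mw) w0 level_S0
  (fun i => coordinate_bound oO p1 hw hg i).
apply: gt0_ler_poweR; first exact: pV0.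
- rewrite in_itv /= leey andbT; apply: integral_ge0 => x _.
  by rewrite lee_fin mulr_ge0 ?powR_ge0.
- by rewrite in_itv /= leey andbT; apply: mule_ge0 => //; rewrite lee_fin ltW.
apply: (le_trans main); rewrite muleA -EFinM; apply: lee_wpmul2r => //.
by rewrite lee_fin /C0 mulrA lerDl.
Qed.
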